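(* Let $A$ be a $C^*$-algebra and $E$ a Hilbert $A$-module. Let $T$ be a regular self-adjoint operator on $E$, and let $R$ be a symmetric operator on $E$ which is relatively $T$-compact. Assume that $T$ and $T+R$ are both invertible. Then the difference of positive spectral projections $P_+(T+R)-P_+(T)$ is compact.
   Context: A densely defined operator $S$ on $E$ is regular if it is closed, $S^*$ is densely defined, and $1+S^*S$ has dense range. For $T$ regular self-adjoint, a densely defined operator $R$ on $E$ is relatively $T$-compact if $\operatorname{Dom}(T)\subset\operatorname{Dom}(R)$ and $R(T\pm i)^{-1}$ is compact, i.e. lies in $\mathcal K_A(E)$, the norm closure of the span of the rank-one operators $\theta_{\psi,\eta}\xi=\psi\langle\eta|\xi\rangle$. If moreover $R$ is symmetric, then $T+R$ is again regular and self-adjoint on $\operatorname{Dom}(T)$. For an invertible regular self-adjoint operator $T$ (so that $0$ is at positive distance from the spectrum), the positive spectral projection $P_+(T)$ is $\chi(T)$ for any continuous $\chi\colon\mathbb R\to\mathbb R$ equal to $0$ on the negative part and $1$ on the positive part of the spectrum of $T$ (continuous functional calculus). *)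

(* Defs.v *)
From HB Require Import structures.
From mathcomp Require Import all_boot all_order all_algebra.
From mathcomp Require Import all_classical all_reals all_analysis.
From mathcomp Require Export complex.

Set Implicit Arguments.
Unset Strict Implicit.
Unset Printing Implicit Defensive.

Import Order.TTheory GRing.Theory Num.Theory.
Import numFieldNormedType.Exports.

Local Open Scope classical_set_scope.
Local Open Scope ring_scope.
Local Open Scope complex_scope.

(* C*-algebras need not be unital, hence not a ring structure of the library.
   Norms of R[i]-modules take values in (the nonnegative reals of) R[i]. *)
HB.mixin Record isCStarAlgebra (R : realType) A of CompleteNormedModule R[i] A := {
  cmul : A -> A -> A ;
  cstar : A -> A ;
  cmulA : forall a b c, cmul a (cmul b c) = cmul (cmul a b) c ;
  cmulDl : forall a b c, cmul (a + b) c = cmul a c + cmul b c ;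
  cmulDr : forall a b c, cmul a (b + c) = cmul a b + cmul a c ;
  cmulZl : forall (z : R[i]) a b, cmul (z *: a) b = z *: cmul a b ;
  cmulZr : forall (z : R[i]) a b, cmul a (z *: b) = z *: cmul a b ;
  cstarK : forall a, cstar (cstar a) = a ;
  cstarD : forall a b, cstar (a + b) = cstar a + cstar b ;
  cstarZ : forall (z : R[i]) a, cstar (z *: a) = z^*%C *: cstar a ;
  cstarM : forall a b, cstar (cmul a b) = cmul (cstar b) (cstar a) ;
  cnormM : forall a b, `|cmul a b| <= `|a| * `|b| ;
  cnorm_star : forall a, `|cmul (cstar a) a| = `|a| ^+ 2
}.

#[short(type="cstarAlgType")]
HB.structure Definition CStarAlgebra (R : realType) :=
  {A of CompleteNormedModule R[i] A & isCStarAlgebra R A}.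

(* Right modules; the inner product is linear in its second argument. An element
   of A is positive when it is of the form b^* b. Completeness of E for the norm
   |<x|x>|^(1/2) comes from the underlying complete normed module. *)
HB.mixin Record isHilbertModule (R : realType) (A : cstarAlgType R) E
    of CompleteNormedModule R[i] E := {
  hact : E -> A -> E ;
  hip : E -> E -> A ;
  hactA : forall x a b, hact (hact x a) b = hact x (cmul a b) ;
  hactDl : forall x y a, hact (x + y) a = hact x a + hact y a ;
  hactDr : forall x a b, hact x (a + b) = hact x a + hact x b ;
  hactZl : forall (z : R[i]) x a, hact (z *: x) a = z *: hact x a ;
  hactZr : forall (z : R[i]) x a, hact x (z *: a) = z *: hact x a ;
  hipDr : forall x y y', hip x (y + y') = hip x y + hip x y' ;
  hipZr : forall (z : R[i]) x y, hip x (z *: y) = z *: hip x y ;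
  hip_act : forall x y a, hip x (hact y a) = cmul (hip x y) a ;
  hip_star : forall x y, cstar (hip x y) = hip y x ;
  hip_ge0 : forall x, exists b : A, hip x x = cmul (cstar b) b ;
  hnormE : forall x, `|x| ^+ 2 = `|hip x x|
}.

#[short(type="hilbertModType")]
HB.structure Definition HilbertModule (R : realType) (A : cstarAlgType R) :=
  {E of CompleteNormedModule R[i] E & isHilbertModule R A E}.

(* Values of [app] outside [dom] are irrelevant. *)
Record operator (E : Type) := Operator { dom : set E ; app :> E -> E }.

Section Operators.
Context {R : realType} {A : cstarAlgType R} {E : hilbertModType A}.
Implicit Types (S T : operator E) (B K P : E -> E).

Definition linear_operator S :=
  [/\ dom S 0,
      forall x y, dom S x -> dom S y -> dom S (x + y) /\ S (x + y) = S x + S y,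
      forall (z : R[i]) x, dom S x -> dom S (z *: x) /\ S (z *: x) = z *: S x &
      forall (a : A) x, dom S x ->
        dom S (hact x a) /\ S (hact x a) = hact (S x) a].

Definition densely_defined S := linear_operator S /\ dense (dom S).

Definition op_eq S T := dom S = dom T /\ forall x, dom S x -> S x = T x.

Definition op_add S T := Operator (dom S `&` dom T) (fun x => S x + T x).

Definition op_shift S (z : R[i]) := Operator (dom S) (fun x => S x + z *: x).

Definition op_comp S T :=
  Operator [set x | dom T x /\ dom S (T x)] (fun x => S (T x)).

Definition op_range S : set E := S @` dom S.

Definition op_inv S :=
  Operator (op_range S) (fun y => xget 0 [set x | dom S x /\ S x = y]).

Definition adj_spec S (y z : E) := forall x, dom S x -> hip z x = hip y (S x).

(* The value is unique when S is densely defined. *)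
Definition op_adj S :=
  Operator [set y | exists z, adj_spec S y z] (fun y => xget 0 (adj_spec S y)).

Definition closed_operator S :=
  closed [set p : E * E | dom S p.1 /\ p.2 = S p.1].

Definition regular_operator S :=
  [/\ densely_defined S, closed_operator S, dense (dom (op_adj S)) &
      dense (op_range (op_shift (op_comp (op_adj S) S) 1))].

Definition self_adjoint S := op_eq S (op_adj S).

Definition symmetric_operator S :=
  forall x y, dom S x -> dom S y -> hip (S x) y = hip x (S y).

Definition adjointable B :=
  exists B' : E -> E, forall x y, hip (B x) y = hip x (B' y).

Definition rank_one (psi eta : E) : E -> E := fun xi => hact psi (hip eta xi).

Definition rank_one_span : set (E -> E) :=
  [set F | exists n (z : 'I_n -> R[i]) (psi eta : 'I_n -> E),
     F = fun xi => \sum_(j < n) z j *: rank_one (psi j) (eta j) xi].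

(* Closure for the operator norm. *)
Definition compact_operator K :=
  forall e : R[i], 0 < e ->
    exists2 F, rank_one_span F & forall xi, `|K xi - F xi| <= e * `|xi|.

Definition relatively_compact T S :=
  [/\ dom T `<=` dom S,
      compact_operator (fun x => S (op_inv (op_shift T 'i%C) x)) &
      compact_operator (fun x => S (op_inv (op_shift T (- 'i%C)) x))].

Definition invertible S :=
  [/\ {in dom S &, injective S}, op_range S = setT & adjointable (op_inv S)].

(* The spectrum of a regular self-adjoint operator is real. *)
Definition spectrum T : set R := [set x | ~ invertible (op_shift T (- x%:C))].

Definition bounded_continuous_on (D : set R) (f : R -> R[i]) :=
  {within D, continuous (f : R -> R[i]^o)} /\
  exists M : R[i], forall x, D x -> `|f x| <= M.

(* Phi is the unital *-homomorphism from C_b(spectrum T) to the adjointable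
   operators that sends x |-> (x +- i)^-1 to (T +- i)^-1. It is unique: its
   restriction to C_0 is determined by Stone-Weierstrass, and is nondegenerate
   because the range of (T + i)^-1 is the dense set Dom T. *)
Definition functional_calculus T (Phi : (R -> R[i]) -> E -> E) :=
  let Cb := bounded_continuous_on (spectrum T) in
  [/\ forall f g, Cb f -> Cb g -> (forall x, spectrum T x -> f x = g x) ->
        Phi f =1 Phi g,
      forall (z : R[i]) f g, Cb f -> Cb g ->
        Phi (fun x => z * f x + g x) =1 fun xi => z *: Phi f xi + Phi g xi,
      (forall f g, Cb f -> Cb g -> Phi (fun x => f x * g x) =1 Phi f \o Phi g) /\
        Phi (fun=> 1) =1 id,
      forall f, Cb f ->
        forall xi eta, hip (Phi f xi) eta = hip xi (Phi (fun x => (f x)^*%C) eta) &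
      Phi (fun x => (x%:C + 'i%C)^-1) =1 op_inv (op_shift T 'i%C) /\
      Phi (fun x => (x%:C - 'i%C)^-1) =1 op_inv (op_shift T (- 'i%C))].

(* P = chi(T); this is meant for invertible T, where it determines P. *)
Definition positive_spectral_projection T P :=
  exists Phi (chi : R -> R),
    [/\ functional_calculus T Phi, continuous chi,
        forall x, spectrum T x -> x < 0 -> chi x = 0,
        forall x, spectrum T x -> 0 < x -> chi x = 1 &
        P =1 Phi (fun x => (chi x)%:C)].

End Operators.

(* Main.v *)
Require Import Defs.
From mathcomp Require Import all_boot all_order all_algebra.
From mathcomp Require Import all_classical all_reals all_analysis.
From mathcomp Require Import ring lra.

Set Implicit Arguments.
Unset Strict Implicit.
Unset Printing Implicit Defensive.

Import Order.TTheory GRing.Theory Num.Theory.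
Import numFieldNormedType.Exports.

Local Open Scope classical_set_scope.
Local Open Scope ring_scope.
Local Open Scope complex_scope.

(* For [b = T^-1], [b' = (T + S)^-1] and [k = S b] one has [b - b' = b' k], and
   [k] is compact; by symmetry of [S] also [b - b' = l b] with [l] compact, the
   adjoint of [S b']. The difference of the projections is made of
   [X = P_-(T + S) P_+(T)] and [P_+(T + S) P_-(T)], which are exchanged by a change
   of sign. Write [y] and [x] for [|T + S|] acting on the left of [X] and [T] on
   its right. The kernel of [X] times [1 + y / x] or [1 + x / y] is that of a
   compact operator, so everything rests on inverting these factors with bounds.

   Where [T] is bounded, [X] is a norm limit of compact operators, obtained by
   iterating a contraction. Where [T] is large, [k] and [l] are small; a dyadic
   paraproduct splits [X] into a part with [x] at most of the order of [y],
   where [1 + x / y] is inverted by a Neumann series, and a symmetric one. The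
   sums over dyadic pieces are bounded by averaging over signs, so that [X] is
   small there as well.

   No positivity in the C*-algebra is used: inequalities follow from the triangle
   inequality in [E], by polarization and by writing real functions bounded by 1
   as means of two unitary ones. *)

(** * Norms and inner products *)

(** Compactness of [b - b'] alone would settle functions vanishing at infinity; a positive
    projection has different limits at the two ends of the line, so compactness of [k] and [l] is
    what counts. With [k] alone the inverse of the factor is [x / (x + y)], a function of
    [log x - log y] with limits 1 and 0: like triangular truncation, it is not bounded as a
    multiplier. Hence two relations. Where [x] is at most of the order of [y], the one with [k]
    reads [(1 + x / y) B = (x / y) K], and the factor [x / y] decays geometrically away from the
    diagonal, so that dyadic sums stay bounded; in the other half the one with [l] gains [y / x].
    The contraction ratio used where [T] is bounded tends to 1 as the cut-off grows, which is why
    large values need a separate argument. The operators behind [y] and [x] do not commute; only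
    finite sums of product symbols [f(y) g(x)] are ever formed, and no calculus in two variables has
    to be built. *)

Section RealNorm.
Context {R : realType} {V : normedModType R[i]}.
Implicit Types x y : V.

(** The order of [R[i]] is partial, so estimates are carried out on the real part. *)
Definition rnorm x : R := complex.Re `|x|.

Lemma rnormE x : `|x| = (rnorm x)%:C.
Proof. by rewrite RRe_real // normr_real. Qed.

Lemma rnorm_ge0 x : 0 <= rnorm x.
Proof. by rewrite -lecR -rnormE normr_ge0. Qed.

Lemma rnormD x y : rnorm (x + y) <= rnorm x + rnorm y.
Proof. by rewrite -lecR rmorphD /= -!rnormE ler_normD. Qed.

Lemma rnormN x : rnorm (- x) = rnorm x.
Proof. by rewrite /rnorm normrN. Qed.

Lemma rnormB x y : rnorm (x - y) <= rnorm x + rnorm y.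
Proof. by rewrite (le_trans (rnormD _ _)) // rnormN. Qed.

Lemma rnormBC x y : rnorm (x - y) = rnorm (y - x).
Proof. by rewrite -rnormN opprB. Qed.

Lemma rnormZ (z : R[i]) x : rnorm (z *: x) = complex.Re `|z| * rnorm x.
Proof.
by rewrite /rnorm normrZ -[`|x|]RRe_real ?normr_real // -[`|z|]RRe_real
  ?normr_real // -rmorphM.
Qed.

Lemma rnormZr (a : R) x : rnorm (a%:C *: x) = `|a| * rnorm x.
Proof. by rewrite rnormZ normc_def /= expr0n addr0 sqrtr_sqr. Qed.

Lemma rnormZi x : rnorm ('i *: x) = rnorm x.
Proof. by rewrite rnormZ normc_def /= expr0n expr1n add0r sqrtr1 mul1r. Qed.

Lemma rnorm0 : rnorm (0 : V) = 0.
Proof. by rewrite /rnorm normr0. Qed.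

Lemma rnorm0_eq0 x : rnorm x = 0 -> x = 0.
Proof. by move=> x0; apply/normr0_eq0; rewrite rnormE x0. Qed.

Lemma rnorm_gt0 x : x != 0 -> 0 < rnorm x.
Proof. by move=> x0; rewrite -ltcR -rnormE normr_gt0. Qed.

Lemma rnorm_le_eps x y : (forall e : R, 0 < e -> rnorm (x - y) <= e) -> x = y.
Proof.
move=> h; apply/eqP; rewrite -subr_eq0; apply/eqP/rnorm0_eq0.
apply/eqP; rewrite eq_le rnorm_ge0 andbT.
by apply/ler_addgt0Pl => e e0; rewrite addr0 h.
Qed.

Lemma dense_rnorm (D : set V) x (e : R) : dense D -> 0 < e ->
  exists2 y, D y & rnorm (x - y) < e.
Proof.
move=> dD e0; have e0C : 0 < e%:C by rewrite ltcR.
have [||y [yb Dy]] := dD (ball x e%:C).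
- by exists x; exact: ballxx.
- exact: ball_open.
- exists y => //; move: yb; rewrite -ball_normE /ball_ /=.
  by rewrite rnormE ltcR.
Qed.

End RealNorm.

Section Complete.
Context {R : realType} {V : completeNormedModType R[i]}.

Lemma rnorm_complete (u : nat -> V) (e : nat -> R) :
    (forall n m, (n <= m)%N -> rnorm (u m - u n) <= e n) ->
    (forall a, 0 < a -> exists n, e n <= a) ->
  exists l, forall n, rnorm (l - u n) <= e n.
Proof.
move=> ue e0.
have /cauchy_cvg/cvg_ex[l ul] : cauchy (u @ \oo).
  apply: cauchy_exP => a a0.
  have aR : a = (complex.Re a)%:C by rewrite RRe_real // gtr0_real.
  have ra0 : 0 < complex.Re a by rewrite -ltcR -aR.
  have [|n en] := e0 (complex.Re a / 2); first by rewrite divr_gt0.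
  exists (u n); exists n => // m /= nm; rewrite -ball_normE /ball_ /=.
  rewrite rnormE aR ltcR rnormBC (le_lt_trans (ue _ _ nm)) //; lra.
exists l => n; apply/ler_addgt0Pl => a a0.
have a0C : 0 < a%:C by rewrite ltcR.
move/cvgrPdist_lt : ul => /(_ _ a0C)[m _ hm].
have := hm (maxn m n) (leq_maxl _ _); rewrite /= rnormE ltcR => h1.
have := ue n _ (leq_maxr m n).
have := rnormD (l - u (maxn m n)) (u (maxn m n) - u n).
rewrite addrA subrK; lra.
Qed.

End Complete.

Section HilbertModule.
Context {R : realType} {A : cstarAlgType R} {E : hilbertModType A}.
Implicit Types (a b : A) (x y : E) (B : E -> E).

Lemma hip0r x : hip x 0 = 0.
Proof. by rewrite -(scale0r (0 : E)) hipZr scale0r. Qed.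

Lemma hipNr x y : hip x (- y) = - hip x y.
Proof. by rewrite -scaleN1r hipZr scaleN1r. Qed.

Lemma hipBr x y y' : hip x (y - y') = hip x y - hip x y'.
Proof. by rewrite hipDr hipNr. Qed.

Lemma hipDl x x' y : hip (x + x') y = hip x y + hip x' y.
Proof. by rewrite -hip_star hipDr cstarD !hip_star. Qed.

Lemma hipZl (z : R[i]) x y : hip (z *: x) y = z^*%C *: hip x y.
Proof. by rewrite -hip_star hipZr cstarZ hip_star. Qed.

Lemma hip0l y : hip 0 y = 0.
Proof. by rewrite -(scale0r (0 : E)) hipZl rmorph0 scale0r. Qed.

Lemma hipNl x y : hip (- x) y = - hip x y.
Proof. by rewrite -scaleN1r hipZl rmorphN1 scaleN1r. Qed.

Lemma hipBl x x' y : hip (x - x') y = hip x y - hip x' y.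
Proof. by rewrite hipDl hipNl. Qed.

Lemma hip_act_l x y a : hip (hact x a) y = cmul (cstar a) (hip x y).
Proof. by rewrite -hip_star hip_act cstarM hip_star. Qed.

Lemma rnorm_hipxx x : rnorm (hip x x) = rnorm x ^+ 2.
Proof. by apply: complexI; rewrite -rnormE -hnormE rnormE rmorphXn. Qed.

Lemma hip_injl x y : (forall z, hip x z = hip y z) -> x = y.
Proof.
move=> h; apply/eqP; rewrite -subr_eq0; apply/eqP/rnorm0_eq0/eqP.
by rewrite -sqrf_eq0 -rnorm_hipxx hipBl h subrr rnorm0.
Qed.

Lemma hip_injr x y : (forall z, hip z x = hip z y) -> x = y.
Proof. by move=> h; apply: hip_injl => z; rewrite -hip_star h hip_star. Qed.

Lemma rnorm_cmul a b : rnorm (cmul a b) <= rnorm a * rnorm b.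
Proof. by rewrite -lecR rmorphM /= -!rnormE cnormM. Qed.

Lemma rnorm_cstar a : rnorm (cstar a) = rnorm a.
Proof.
have le (c : A) : rnorm c <= rnorm (cstar c).
  have [->|/rnorm_gt0 c0] := eqVneq c 0; first by rewrite rnorm0 rnorm_ge0.
  rewrite -(ler_pM2r c0); apply: (le_trans _ (rnorm_cmul _ _)).
  by rewrite -lecR -rnormE cnorm_star rnormE -rmorphXn.
by apply/eqP; rewrite eq_le le -{2}(cstarK a) le.
Qed.

Lemma rnorm_hact x a : rnorm (hact x a) <= rnorm x * rnorm a.
Proof.
rewrite -ler_sqr ?nnegrE ?mulr_ge0 ?rnorm_ge0 //.
rewrite -rnorm_hipxx hip_act hip_act_l.
rewrite (le_trans (rnorm_cmul _ _)) // exprMn [rnorm a ^+ 2]expr2 mulrA.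
rewrite ler_wpM2r ?rnorm_ge0 // mulrC -rnorm_hipxx.
by rewrite (le_trans (rnorm_cmul _ _)) // rnorm_cstar.
Qed.

Lemma hip_polarization x y :
  hip x y *+ 4 = (hip (x + y) (x + y) - hip (x - y) (x - y))
  - 'i *: (hip (x + 'i *: y) (x + 'i *: y) - hip (x - 'i *: y) (x - 'i *: y)).
Proof.
have par (u v : E) : hip (u + v) (u + v) - hip (u - v) (u - v) =
    (hip u v + hip v u) *+ 2.
  have -> : hip (u + v) (u + v) = (hip u u + hip v v) + (hip u v + hip v u).
    by rewrite hipDl !hipDr [hip v u + _]addrC addrACA.
  have -> : hip (u - v) (u - v) = (hip u u + hip v v) - (hip u v + hip v u).
    by rewrite hipBl !hipBr opprB addrACA -opprD.
  by rewrite opprB [hip u v + hip v u - _]addrC addrACA subrr add0r mulr2n.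
rewrite !par hipZr hipZl -scalerMnr scalerDr !scalerA.
have -> : 'i%C * 'i%C = -1 :> R[i] by rewrite -sqr_i expr2.
have -> : 'i%C * ('i%C)^*%C = 1 :> R[i] by simpc; congr (_ +i* _); ring.
rewrite scaleN1r scale1r -mulrnBl opprD opprK.
by rewrite addrACA subrr addr0 -mulr2n -mulrnA.
Qed.

(* The sharp constant 1 requires positivity in [A]; the triangle inequality of
   [E] already gives the constant 4, through polarization. *)
Lemma rnorm_hip x y : rnorm (hip x y) <= 4 * (rnorm x * rnorm y).
Proof.
have unit (u v : E) : rnorm u = 1 -> rnorm v = 1 -> rnorm (hip u v) <= 4.
  move=> u1 v1; rewrite -(ler_pM2l (@ltr0Sn R 3)).
  have h4 (a : A) : 4 * rnorm a = rnorm (a *+ 4).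
    have -> : a *+ 4 = (4%:R : R)%:C *: a by rewrite rmorph_nat scaler_nat.
    by rewrite rnormZr normr_nat.
  have sq (w : E) : rnorm w <= 2 -> rnorm (hip w w) <= 4.
    move=> w2; rewrite rnorm_hipxx; have := rnorm_ge0 w; nra.
  rewrite h4 hip_polarization (le_trans (rnormB _ _)) // rnormZi.
  have iv : rnorm ('i *: v) = 1 by rewrite rnormZi.
  have a1 : rnorm (hip (u + v) (u + v)) <= 4.
    by apply: sq; have := rnormD u v; lra.
  have a2 : rnorm (hip (u - v) (u - v)) <= 4.
    by apply: sq; have := rnormB u v; lra.
  have a3 : rnorm (hip (u + 'i *: v) (u + 'i *: v)) <= 4.
    by apply: sq; have := rnormD u ('i *: v); lra.
  have a4 : rnorm (hip (u - 'i *: v) (u - 'i *: v)) <= 4.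
    by apply: sq; have := rnormB u ('i *: v); lra.
  have := rnormB (hip (u + v) (u + v)) (hip (u - v) (u - v)).
  have := rnormB (hip (u + 'i *: v) (u + 'i *: v))
    (hip (u - 'i *: v) (u - 'i *: v)).
  lra.
have [->|/rnorm_gt0 x0] := eqVneq x 0.
  by rewrite -hip_star hip0r rnorm_cstar !rnorm0 mul0r mulr0.
have [->|/rnorm_gt0 y0] := eqVneq y 0.
  by rewrite hip0r !rnorm0 !mulr0.
pose u := (rnorm x)^-1%:C *: x; pose v := (rnorm y)^-1%:C *: y.
have nu : rnorm u = 1 by rewrite rnormZr gtr0_norm ?invr_gt0// mulVf ?gt_eqF.
have nv : rnorm v = 1 by rewrite rnormZr gtr0_norm ?invr_gt0// mulVf ?gt_eqF.
have := unit _ _ nu nv.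
rewrite hipZr hipZl conjc_real !rnormZr !gtr0_norm ?invr_gt0 //.
by rewrite mulrA -invfM ler_pdivrMl ?mulr_gt0 // => /le_trans; apply; lra.
Qed.

(** Such a [B] is automatically [A]-linear, by the lemmas below, and bounded, by
    [adjoint_pair_bounded]. *)
Definition adjoint_pair B B' := forall x y, hip (B x) y = hip x (B' y).

Definition bounded_by (c : R) B := forall x, rnorm (B x) <= c * rnorm x.

Section AdjointPair.
Context {B B' : E -> E} (BB' : adjoint_pair B B').

Lemma adjoint_pairC : adjoint_pair B' B.
Proof. by move=> x y; rewrite -hip_star -BB' hip_star. Qed.

Lemma adjoint_pair_add x y : B (x + y) = B x + B y.
Proof. by apply: hip_injl => z; rewrite hipDl !BB' hipDl. Qed.

Lemma adjoint_pair_scale (z : R[i]) x : B (z *: x) = z *: B x.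
Proof. by apply: hip_injl => w; rewrite hipZl !BB' hipZl. Qed.

Lemma adjoint_pair_act x a : B (hact x a) = hact (B x) a.
Proof. by apply: hip_injl => w; rewrite hip_act_l !BB' hip_act_l. Qed.

Lemma adjoint_pair_opp x : B (- x) = - B x.
Proof. by rewrite -scaleN1r adjoint_pair_scale scaleN1r. Qed.

Lemma adjoint_pair_sub x y : B (x - y) = B x - B y.
Proof. by rewrite adjoint_pair_add adjoint_pair_opp. Qed.

Lemma adjoint_pair0 : B 0 = 0.
Proof. by rewrite -(scale0r (0 : E)) adjoint_pair_scale !scale0r. Qed.

Lemma adjoint_pair_sum (I : Type) (r : seq I) (P : pred I) (F : I -> E) :
  B (\sum_(i <- r | P i) F i) = \sum_(i <- r | P i) B (F i).
Proof.
by apply: big_morph; [exact: adjoint_pair_add | exact: adjoint_pair0].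
Qed.

End AdjointPair.

Lemma bounded_by_adjoint (c : R) B B' : adjoint_pair B B' ->
  0 <= c -> bounded_by c B -> bounded_by (4 * c) B'.
Proof.
move=> BB' c0 Bc x.
have [->|/rnorm_gt0 x0] := eqVneq (B' x) 0.
  by rewrite rnorm0 !mulr_ge0 ?rnorm_ge0.
rewrite -(ler_pM2r x0) -expr2 -rnorm_hipxx -BB' (le_trans (rnorm_hip _ _)) //.
rewrite -!mulrA ler_pM2l // [rnorm x * _]mulrC mulrA ler_wpM2r ?rnorm_ge0 //.
Qed.

End HilbertModule.

(** * Uniform boundedness and automatic continuity *)

Section Bounded.
Context {R : realType} {A : cstarAlgType R} {E : hilbertModType A}.
Implicit Types (x y : E) (B K : E -> E).

Lemma exprn_le_eps (r a : R) : 0 <= r -> r < 1 -> 0 < a ->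
  exists n, r ^+ n <= a.
Proof.
move=> r0 r1 a0.
have /cvgrPdist_le/(_ _ a0)[n _ /(_ n (leqnn n))] : GRing.exp r @ \oo --> (0 : R).
  by apply: cvg_expr; rewrite ger0_norm.
by rewrite /= sub0r normrN ger0_norm ?exprn_ge0 // => h; exists n.
Qed.

(* Gliding hump: [x = sum_n (+-) 9^-n z_n / |z_n|], each sign being chosen so
   that adding the n-th term makes [<x | z_n>] large. *)
Lemma weakly_bounded (Z : set E) :
    (forall x, exists M : R, forall z, Z z -> rnorm (hip x z) <= M) ->
  exists2 C : R, 0 <= C & forall z, Z z -> rnorm z <= C.
Proof.
move=> weakZ; apply: contrapT => nbd.
have big (C : R) : exists z, Z z /\ C < rnorm z.
  apply: contrapT => nz; apply: nbd; exists `|C| => // z Zz.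
  rewrite leNgt; apply/negP => h; apply: nz; exists z; split => //.
  by rewrite (le_lt_trans (ler_norm C)).
(* With 9, the tail after step [n] is at most [9 / 8 * p n.+1 = p n / 8]; the factor 4 of
   [rnorm_hip] turns it into half of [p n * rnorm (z n)], and the half that remains is at least
   [n + 1] by [zr]. *)
pose p n : R := 9 ^- n.
have p0 n : 0 < p n by rewrite invr_gt0 exprn_gt0.
have pS n : p n = 9 * p n.+1.
  by rewrite /p exprS invfM mulrA divff // mul1r.
have [z hz] := choice (fun n => big (2 * (n%:R + 1) / p n)).
have zZ n : Z (z n) by case: (hz n).
have zr n : n%:R + 1 <= 2^-1 * p n * rnorm (z n).
  case: (hz n) => _ /ltW; rewrite ler_pdivrMr //; lra.
have z0 n : 0 < rnorm (z n).
  case: (hz n) => _; apply: le_lt_trans.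
  by rewrite divr_ge0 ?(ltW (p0 n)) // mulr_ge0 // addr_ge0.
pose w n := (p n / rnorm (z n))%:C *: z n.
have rw n : rnorm (w n) = p n.
  by rewrite rnormZr gtr0_norm ?divr_gt0 // divfK // gt_eqF.
have hw n : rnorm (hip (w n) (z n)) = p n * rnorm (z n).
  rewrite hipZl conjc_real rnormZr rnorm_hipxx gtr0_norm ?divr_gt0 //.
  by rewrite expr2 mulrA divfK // gt_eqF.
pose step n x := if p n * rnorm (z n) <= rnorm (hip (x + w n) (z n))
  then x + w n else x - w n.
pose u := fix u n := if n is m.+1 then step m (u m) else 0.
have step_big n x : p n * rnorm (z n) <= rnorm (hip (step n x) (z n)).
  rewrite /step; case: ifPn => //; rewrite -ltNge => h.
  have := rnormB (hip (x + w n) (z n)) (hip (x - w n) (z n)).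
  rewrite -hipBl.
  have -> : x + w n - (x - w n) = w n *+ 2.
    by rewrite opprB addrC addrA subrK mulr2n.
  have -> : hip (w n *+ 2) (z n) = (2%:R : R)%:C *: hip (w n) (z n).
    by rewrite rmorph_nat scaler_nat !mulr2n hipDl.
  rewrite rnormZr normr_nat hw; lra.
have step_near n x : rnorm (step n x - x) = p n.
  by rewrite /step; case: ifP => _; rewrite addrC addKr ?rnormN rw.
have cu n m : (n <= m)%N -> rnorm (u m - u n) <= 9 / 8 * p n.
  move=> /subnK <-; move: (m - n)%N => k; elim: k n => [|k ih] n.
    by rewrite add0n subrr rnorm0 mulr_ge0 ?(ltW (p0 n)) // divr_ge0.
  have := rnormD (u (k + n.+1)%N - u n.+1) (u n.+1 - u n).
  rewrite addrA subrK addSnnS step_near; have := ih n.+1; have := pS n; lra.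
have [|l ul] := rnorm_complete cu.
  move=> a a0; have a80 : 0 < 8 / 9 * a by lra.
  have q1 : 9^-1 < 1 :> R by rewrite invf_lt1 ?ltr1n.
  have q0 : 0 <= 9^-1 :> R by rewrite invr_ge0.
  have [n hn] := exprn_le_eps q0 q1 a80.
  by exists n; rewrite /p -exprVn; lra.
have [M hM] := weakZ l.
have key n : n%:R + 1 <= M.
  have := hM _ (zZ n); have := ul n.+1; have := step_big n (u n).
  have := rnorm_hip (l - u n.+1) (z n).
  have := rnormB (hip l (z n)) (hip (l - u n.+1) (z n)).
  rewrite -hipBl opprB addrC subrK [u n.+1]/=.
  move: (zr n) (z0 n) (pS n) (p0 n) (rnorm_ge0 (l - step n (u n))); nra.
have := key (Num.truncn M).+1; have := truncnS_gt M; lra.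
Qed.

(** Hellinger-Toeplitz: the vectors [B' y] with [y] in [D] of norm at most 1 are weakly bounded,
    since [hip x (B' y) = hip (B x) y], hence bounded in norm. A dense [D] is allowed for the sake
    of [S b'], whose formal adjoint [b' S] lives on [dom S] only. *)
Lemma dense_adjoint_bounded B (D : set E) (B' : E -> E) : dense D ->
    (forall (a : R[i]) y, D y -> D (a *: y) /\ B' (a *: y) = a *: B' y) ->
    (forall x y, D y -> hip (B x) y = hip x (B' y)) ->
  exists2 C : R, 0 <= C & bounded_by C B.
Proof.
move=> dD linB' BB'.
have [x|C C0 hC] :=
    @weakly_bounded [set B' y | y in [set y | D y /\ rnorm y <= 1]].
  exists (4 * rnorm (B x)) => _ [y [Dy y1] <-]; rewrite -BB' //.
  by rewrite (le_trans (rnorm_hip _ _)) // ler_pM2l // ler_piMr ?rnorm_ge0.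
have hip_le x y : D y -> rnorm (hip (B x) y) <= 4 * rnorm x * C * rnorm y.
  move=> Dy; have [->|/rnorm_gt0 y0] := eqVneq y 0.
    by rewrite hip0r !rnorm0 mulr0.
  rewrite BB' // (le_trans (rnorm_hip _ _)) // -!mulrA !ler_wpM2l ?rnorm_ge0 //.
  have [Dy' B'y'] := linB' (rnorm y)^-1%:C y Dy.
  have := hC (B' ((rnorm y)^-1%:C *: y)).
  rewrite B'y' rnormZr gtr0_norm ?invr_gt0 // ler_pdivrMl // mulrC; apply.
  exists ((rnorm y)^-1%:C *: y); rewrite ?B'y' //; split => //.
  by rewrite rnormZr gtr0_norm ?invr_gt0 // mulVf // gt_eqF.
exists (9 * C); first by rewrite mulr_ge0.
move=> x; have [->|/rnorm_gt0 w0] := eqVneq (B x) 0.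
  by rewrite rnorm0 !mulr_ge0 ?rnorm_ge0.
(* Replacing [B x] by [y] in [hip (B x) (B x)] costs at most half of its norm, because of the factor
   4; what is left is [rnorm (B x) ^+ 2 / 2 <= 4 C * rnorm x * (9 / 8) * rnorm (B x)], whence 9. *)
have e0 : 0 < rnorm (B x) / 8 by rewrite divr_gt0.
have [y Dy yx] := dense_rnorm (B x) dD e0.
have h1 := hip_le x y Dy.
have h2 : rnorm (B x) ^+ 2 <= rnorm (hip (B x) y) + 4 * (rnorm (B x) * rnorm (B x - y)).
  rewrite -rnorm_hipxx -{2}(subrK y (B x)) hipDr addrC.
  by rewrite (le_trans (rnormD _ _)) // lerD2l rnorm_hip.
have h3 : rnorm y <= rnorm (B x) + rnorm (B x - y).
  by have := rnormB (B x) (B x - y); rewrite opprB addrC subrK.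
rewrite -(ler_pM2r w0).
have C4 : 0 <= 4 * rnorm x * C by rewrite !mulr_ge0 ?rnorm_ge0.
have h4 : 4 * rnorm x * C * rnorm y <= 4 * rnorm x * C * (9 / 8 * rnorm (B x)).
  by rewrite ler_wpM2l //; lra.
have h5 : rnorm (B x) * rnorm (B x - y) <= rnorm (B x) * (rnorm (B x) / 8).
  by rewrite ler_wpM2l ?rnorm_ge0 // ltW.
nra.
Qed.

Lemma adjoint_pair_bounded B B' : adjoint_pair B B' ->
  exists2 C : R, 0 <= C & bounded_by C B.
Proof.
move=> BB'; apply: (@dense_adjoint_bounded B setT B').
- by move=> O [x Ox] _; exists x.
- by move=> a y _; split => //; rewrite (adjoint_pair_scale (adjoint_pairC BB')).
- by move=> x y _; rewrite BB'.
Qed.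

End Bounded.

(** * Compact operators *)

Section Compact.
Context {R : realType} {A : cstarAlgType R} {E : hilbertModType A}.
Implicit Types (x y : E) (B K L F : E -> E).

Lemma rank_one_spanP F : rank_one_span F <-> exists s : seq (R[i] * E * E),
  F = fun x => \sum_(t <- s) t.1.1 *: rank_one t.1.2 t.2 x.
Proof.
split=> [[n [z [psi [eta ->]]]]|[s ->]].
  exists [seq (z j, psi j, eta j) | j <- enum 'I_n].
  by apply/funext => x; rewrite big_map big_enum.
exists (size s), (fun j => (tnth (in_tuple s) j).1.1),
  (fun j => (tnth (in_tuple s) j).1.2), (fun j => (tnth (in_tuple s) j).2).
by apply/funext => x; rewrite big_tnth.
Qed.

(** The factor 4 is that of [rnorm_hip]. *)
Lemma rnorm_rank_one (psi eta x : E) :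
  rnorm (rank_one psi eta x) <= 4 * rnorm psi * rnorm eta * rnorm x.
Proof.
rewrite (le_trans (rnorm_hact _ _)) //.
rewrite (le_trans (ler_wpM2l (rnorm_ge0 psi) (rnorm_hip eta x))) //; lra.
Qed.

Lemma rank_one_adjoint (psi eta : E) :
  adjoint_pair (rank_one psi eta) (rank_one eta psi).
Proof. by move=> x y; rewrite /rank_one hip_act_l hip_star hip_act. Qed.

Lemma rank_one_span_adjoint F : rank_one_span F ->
  exists2 F', adjoint_pair F F' & rank_one_span F'.
Proof.
move=> /rank_one_spanP[s ->].
exists (fun x => \sum_(t <- [seq (t.1.1^*%C, t.2, t.1.2) | t <- s])
  t.1.1 *: rank_one t.1.2 t.2 x); last by apply/rank_one_spanP; eexists.
move=> x y; elim: s => [|t s ih].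
  by rewrite !big_nil hip0l hip0r.
rewrite /= !big_cons hipDl hipDr ih hipZl hipZr; congr (_ *: _ + _).
exact: rank_one_adjoint.
Qed.

Lemma compact_operatorP K : compact_operator K <->
  forall e : R, 0 < e ->
    exists2 F, rank_one_span F & bounded_by e (fun x => K x - F x).
Proof.
split=> h e e0.
  have [|F F1 hF] := h e%:C; first by rewrite ltcR.
  by exists F => // x; rewrite -lecR rmorphM /= -!rnormE.
have eR : e = (complex.Re e)%:C by rewrite RRe_real // gtr0_real.
have [|F F1 hF] := h (complex.Re e); first by rewrite -ltcR -eR.
by exists F => // x; rewrite eR !rnormE -rmorphM lecR.
Qed.

Lemma compact_closed K :
    (forall e : R, 0 < e ->
      exists2 L, compact_operator L & bounded_by e (fun x => K x - L x)) ->
  compact_operator K.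
Proof.
move=> h; apply/compact_operatorP => e e0.
have e20 : 0 < e / 2 by rewrite divr_gt0.
have [L /compact_operatorP/(_ _ e20)[F F1 hF] hL] := h _ e20.
exists F => // x; have := rnormD (K x - L x) (L x - F x).
rewrite addrA subrK; have := hL x; have := hF x; rewrite /=; nra.
Qed.

Lemma rank_one_span_compact F : rank_one_span F -> compact_operator F.
Proof.
move=> F1; apply/compact_operatorP => e e0; exists F => // x.
by rewrite subrr rnorm0 mulr_ge0 ?rnorm_ge0 // ltW.
Qed.

Lemma compact0 : compact_operator (fun _ : E => 0).
Proof.
apply: rank_one_span_compact; apply/rank_one_spanP; exists [::].
by apply/funext => x; rewrite big_nil.
Qed.

Lemma compactD K L : compact_operator K -> compact_operator L ->
  compact_operator (fun x => K x + L x).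
Proof.
move=> /compact_operatorP cK /compact_operatorP cL.
apply/compact_operatorP => e e0.
have e20 : 0 < e / 2 by rewrite divr_gt0.
have [F /rank_one_spanP[s ->] hF] := cK _ e20.
have [G /rank_one_spanP[t ->] hG] := cL _ e20.
exists (fun x => \sum_(i <- s ++ t) i.1.1 *: rank_one i.1.2 i.2 x).
  by apply/rank_one_spanP; eexists.
move=> x; rewrite big_cat /= opprD addrACA (le_trans (rnormD _ _)) //.
have := hF x; have := hG x; rewrite /=; nra.
Qed.

Lemma compactZ (z : R[i]) K : compact_operator K ->
  compact_operator (fun x => z *: K x).
Proof.
move=> /compact_operatorP cK; apply/compact_operatorP => e e0.
have [c c0 zc] : exists2 c, 0 <= c & forall x, rnorm (z *: x) = c * rnorm x.
  exists (complex.Re `|z|); last by move=> x; rewrite rnormZ.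
  by rewrite -lecR RRe_real ?normr_real // normr_ge0.
have c1 : 0 < 1 + c by lra.
have [|F /rank_one_spanP[s ->] hF] := cK (e / (1 + c)).
  by rewrite divr_gt0.
exists (fun x => \sum_(i <- [seq (z * i.1.1, i.1.2, i.2) | i <- s])
    i.1.1 *: rank_one i.1.2 i.2 x); first by apply/rank_one_spanP; eexists.
move=> x.
have -> : z *: K x - \sum_(i <- [seq (z * i.1.1, i.1.2, i.2) | i <- s])
    i.1.1 *: rank_one i.1.2 i.2 x =
    z *: (K x - \sum_(i <- s) i.1.1 *: rank_one i.1.2 i.2 x).
  rewrite scalerBr big_map scaler_sumr; congr (_ - _).
  by apply: eq_bigr => i _; rewrite scalerA.
rewrite zc; have := hF x; rewrite /= mulrAC ler_pdivlMr //.
move: (rnorm_ge0 (K x - \sum_(i <- s) i.1.1 *: rank_one i.1.2 i.2 x)); nra.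
Qed.

Lemma compactN K : compact_operator K -> compact_operator (fun x => - K x).
Proof.
by move=> /(compactZ (-1)); under eq_fun do rewrite scaleN1r.
Qed.

Lemma compactB K L : compact_operator K -> compact_operator L ->
  compact_operator (fun x => K x - L x).
Proof. by move=> cK /compactN; exact: compactD. Qed.

Lemma compact_sum (I : Type) (s : seq I) (K : I -> E -> E) :
    (forall i, compact_operator (K i)) ->
  compact_operator (fun x => \sum_(i <- s) K i x).
Proof.
move=> cK; elim: s => [|i s ih].
  by under eq_fun do rewrite big_nil; exact: compact0.
by under eq_fun do rewrite big_cons; exact: compactD.
Qed.

Lemma compact_compl B B' K : adjoint_pair B B' -> compact_operator K ->
  compact_operator (B \o K).
Proof.
move=> BB' /compact_operatorP cK; apply/compact_operatorP => e e0.
have [C C0 hC] := adjoint_pair_bounded BB'.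
have [|F /rank_one_spanP[s ->] hF] := cK (e / (1 + C)).
  by rewrite divr_gt0 // ltr_wpDr.
exists (fun x => \sum_(i <- [seq (i.1.1, B i.1.2, i.2) | i <- s])
    i.1.1 *: rank_one i.1.2 i.2 x); first by apply/rank_one_spanP; eexists.
move=> x /=.
have -> : \sum_(i <- [seq (i.1.1, B i.1.2, i.2) | i <- s])
    i.1.1 *: rank_one i.1.2 i.2 x =
    B (\sum_(i <- s) i.1.1 *: rank_one i.1.2 i.2 x).
  rewrite big_map (adjoint_pair_sum BB'); apply: eq_bigr => i _.
  by rewrite (adjoint_pair_scale BB') /rank_one (adjoint_pair_act BB').
rewrite -(adjoint_pair_sub BB') (le_trans (hC _)) //.
have := hF x; rewrite /= mulrAC ler_pdivlMr; last lra.
move: (rnorm_ge0 (K x - \sum_(i <- s) i.1.1 *: rank_one i.1.2 i.2 x)); nra.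
Qed.

(* [G] need not be adjointable, and its formal adjoint only densely defined. *)
Lemma compact_compr_dense K G (D : set E) (G' : E -> E) (C : R) : dense D ->
    bounded_by C G -> (forall x y, D y -> hip (G x) y = hip x (G' y)) ->
  compact_operator K -> compact_operator (K \o G).
Proof.
move=> dD hC GG' cK.
have C0 : 0 <= 1 + `|C| by rewrite addr_ge0.
have hC' x : rnorm (G x) <= (1 + `|C|) * rnorm x.
  by rewrite (le_trans (hC x)) // ler_wpM2r ?rnorm_ge0 // ler_wpDl ?ler_norm.
have C1 : 0 < 1 + `|C| by rewrite ltr_wpDr.
apply: compact_closed => e e0.
have eC0 : 0 < e / (1 + `|C|) by rewrite divr_gt0.
have /compact_operatorP/(_ _ eC0)[F /rank_one_spanP[s ->] hF] := cK.
exists (fun x => \sum_(t <- s) t.1.1 *: rank_one t.1.2 t.2 (G x)); last first.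
  move=> x /=; rewrite (le_trans (hF _)) // mulrAC ler_pdivrMr //.
  by rewrite -mulrA ler_wpM2l ?(ltW e0) // mulrC hC'.
apply: compact_sum => -[[z psi] eta] /=; apply: compactZ.
apply: compact_closed => a a0.
have b0 : 0 < a / (1 + 4 * rnorm psi * (1 + `|C|)).
  by rewrite divr_gt0 // ltr_wpDr // !mulr_ge0 ?rnorm_ge0.
(* Once [eta] is moved into [D], the operator [G] passes to the other side of the inner product and
   the composite is again of rank one. *)
have [eta' D' he] := dense_rnorm eta dD b0.
exists (rank_one psi (G' eta')).
  apply: rank_one_span_compact; apply/rank_one_spanP; exists [:: (1, psi, G' eta')].
  by apply/funext => x; rewrite big_seq1 scale1r.
move=> x; have -> : rank_one psi eta (G x) - rank_one psi (G' eta') x =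
    rank_one psi (eta - eta') (G x).
  rewrite /rank_one -[hip (G' _) _]hip_star -GG' // hip_star.
  by rewrite -scaleN1r -hactZr -hactDr scaleN1r hipBl.
rewrite (le_trans (rnorm_rank_one _ _ _)) //.
move: he; rewrite ltr_pdivlMr; last first.
  by rewrite ltr_wpDr // !mulr_ge0 ?rnorm_ge0.
move=> /ltW he.
have -> : 4 * rnorm psi * rnorm (eta - eta') * rnorm (G x) =
  (rnorm (eta - eta') * (4 * rnorm psi)) * rnorm (G x) by ring.
have h1 := hC' x.
have h2 : 0 <= rnorm (eta - eta') * (4 * rnorm psi) by rewrite !mulr_ge0 ?rnorm_ge0.
have h3 : rnorm (eta - eta') * (4 * rnorm psi) * (1 + `|C|) <= a.
  by have := rnorm_ge0 (eta - eta'); lra.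
rewrite (le_trans (ler_wpM2l h2 h1)) //.
by have := ler_wpM2r (rnorm_ge0 x) h3; rewrite -[_ * (1 + _) * _]mulrA.
Qed.

Lemma compact_compr K G G' : adjoint_pair G G' -> compact_operator K ->
  compact_operator (K \o G).
Proof.
move=> GG'; have [C _ hC] := adjoint_pair_bounded GG'.
apply: (@compact_compr_dense K G setT G' C) => //.
by move=> O [x Ox] _; exists x.
Qed.

(** [K] is given only as a norm limit. The approximants do have adjoints, again in the span of
    rank-one operators, and these form a Cauchy sequence because passing to adjoints costs at most a
    factor 4. *)
Lemma compact_adjoint K : compact_operator K ->
  exists2 K', adjoint_pair K K' & compact_operator K'.
Proof.
move=> /compact_operatorP cK; pose p n : R := 2^-1 ^+ n.
have p0 n : 0 < p n by rewrite exprn_gt0 // invr_gt0.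
have pm n m : (n <= m)%N -> p m <= p n.
  by move=> nm; rewrite ler_wiXn2l ?invr_ge0 // invf_le1 ?ler1n.
have pe (a : R) : 0 < a -> exists n, p n <= a.
  by apply: exprn_le_eps; rewrite ?invr_ge0 // invf_lt1 ?ltr1n.
have /choice[F hF] n : exists F : (E -> E) * (E -> E),
    [/\ adjoint_pair F.1 F.2, rank_one_span F.2 &
        bounded_by (p n) (fun x => K x - F.1 x)].
  have [G G1 hG] := cK _ (p0 n); have [G' GG' G'1] := rank_one_span_adjoint G1.
  by exists (G, G').
have adjF n : adjoint_pair (F n).1 (F n).2 by case: (hF n).
have cauchy x n m : (n <= m)%N ->
    rnorm ((F m).2 x - (F n).2 x) <= 8 * rnorm x * p n.
  move=> nm.
  have h : bounded_by (4 * (2 * p n)) (fun x => (F m).2 x - (F n).2 x).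
    apply: (@bounded_by_adjoint _ _ _ _ (fun x => (F m).1 x - (F n).1 x)).
    - by move=> y z; rewrite hipBl hipBr !adjF.
    - by rewrite mulr_ge0 // ltW.
    move=> y /=; have [_ _ /(_ y)/= h1] := hF n.
    have [_ _ /(_ y)/= h2] := hF m; have := pm _ _ nm.
    have := rnormB (K y - (F n).1 y) (K y - (F m).1 y).
    rewrite opprB addrC addrA subrK addrC; have := rnorm_ge0 y; nra.
  by have -> : 8 * rnorm x * p n = 4 * (2 * p n) * rnorm x by ring.
have /choice[K' hK'] x : exists l, forall n,
    rnorm (l - (F n).2 x) <= 8 * rnorm x * p n.
  apply: rnorm_complete => [n m|a a0]; first exact: cauchy.
  have [|n hn] := pe (a / (1 + 8 * rnorm x)).
    by rewrite divr_gt0 // ltr_wpDr // mulr_ge0 ?rnorm_ge0.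
  exists n; move: hn; rewrite ler_pdivlMr.
    by have := p0 n; have := rnorm_ge0 x; nra.
  by rewrite ltr_wpDr // mulr_ge0 ?rnorm_ge0.
exists K'; last first.
  apply: compact_closed => e e0; have [|n hn] := pe (e / 8).
    by rewrite divr_gt0.
  exists (F n).2; first by apply: rank_one_span_compact; case: (hF n).
  by move=> x /=; have := hK' x n; have := rnorm_ge0 x; nra.
move=> x y; apply: rnorm_le_eps => e e0.
have xy0 : 0 <= rnorm x * rnorm y by rewrite mulr_ge0 ?rnorm_ge0.
have [|n hn] := pe (e / (1 + 36 * (rnorm x * rnorm y))).
  by rewrite divr_gt0 // ltr_wpDr // mulr_ge0.
have -> : hip (K x) y - hip x (K' y) =
    hip (K x - (F n).1 x) y - hip x (K' y - (F n).2 y).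
  by rewrite hipBl hipBr adjF opprB addrC addrA subrK [RHS]addrC.
rewrite (le_trans (rnormB _ _)) //.
have [_ _ /(_ x)/= h1] := hF n; have h2 := hK' y n.
have := rnorm_hip (K x - (F n).1 x) y.
have := rnorm_hip x (K' y - (F n).2 y).
move: hn; rewrite ler_pdivlMr; last by rewrite ltr_wpDr // mulr_ge0.
have h3 : rnorm (K x - (F n).1 x) * rnorm y <= p n * rnorm x * rnorm y.
  by rewrite ler_wpM2r ?rnorm_ge0.
have h4 : rnorm x * rnorm (K' y - (F n).2 y) <= rnorm x * (8 * rnorm y * p n).
  by rewrite ler_wpM2l ?rnorm_ge0.
have := p0 n; nra.
Qed.

End Compact.

(** * Dyadic functions on the line *)

Section ContinuousBounded.
Context {R : realType}.
Implicit Types (f g : R -> R) (a b x : R).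

(** Functions on the whole line lie in the domain of the calculus of every operator, so the same
    function can be fed to those of [T] and [T + S]. *)
Definition cbounded f := continuous f /\ exists M, forall x, `|f x| <= M.

Lemma cbounded_cst a : cbounded (fun=> a).
Proof. by split; [exact: cst_continuous | exists `|a|]. Qed.

Lemma cboundedD f g : cbounded f -> cbounded g -> cbounded (fun x => f x + g x).
Proof.
move=> [cf [M hM]] [cg [N hN]]; split; first by move=> x; exact: (cvgD (cf x) (cg x)).
by exists (M + N) => x; rewrite (le_trans (ler_normD _ _)) // lerD.
Qed.

Lemma cboundedM f g : cbounded f -> cbounded g -> cbounded (fun x => f x * g x).
Proof.
move=> [cf [M hM]] [cg [N hN]]; split; first by move=> x; exact: (cvgM (cf x) (cg x)).
by exists (M * N) => x; rewrite normrM ler_pM.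
Qed.

Lemma cboundedZ a f : cbounded f -> cbounded (fun x => a * f x).
Proof. exact/cboundedM/cbounded_cst. Qed.

Lemma cboundedB f g : cbounded f -> cbounded g -> cbounded (fun x => f x - g x).
Proof.
move=> cf /(cboundedZ (-1)) cg.
by under eq_fun do rewrite -mulN1r; exact: cboundedD.
Qed.

Lemma cboundedN f : cbounded f -> cbounded (fun x => - f x).
Proof. by move=> /(cboundedZ (-1)); under eq_fun do rewrite mulN1r. Qed.

Lemma cbounded_clip f a b : continuous f ->
  cbounded (fun x => Num.min b (Num.max a (f x))).
Proof.
move=> cf; split.
  apply: min_fun_continuous; first exact: cst_continuous.
  by apply: max_fun_continuous => //; exact: cst_continuous.
exists (`|a| + `|b|) => x; rewrite ler_norml; apply/andP; split.
  rewrite le_min; apply/andP; split.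
    by have := ler_norm (- b); rewrite normrN; have := normr_ge0 a; lra.
  rewrite le_max; apply/orP; left.
  by have := ler_norm (- a); rewrite normrN; have := normr_ge0 b; lra.
apply: (@le_trans _ _ b); first by rewrite ge_min lexx.
by have := ler_norm b; have := normr_ge0 a; lra.
Qed.

Lemma cbounded_comp_opp f : cbounded f -> cbounded (fun x => f (- x)).
Proof.
move=> [cf [M hM]]; split; last by exists M.
by move=> x; apply: continuous_comp; [exact: opp_continuous | exact: cf].
Qed.

End ContinuousBounded.

Section Scale.
Context {R : realType} {c : R} (c_gt0 : 0 < c).
Implicit Types (x : R) (j n : nat).

(** The ratio must be close enough to 1 for the later Neumann series. With ratio [q], its
    contraction factor is [(q ^ 2 - q / 2) / (1 + q / 2)], below 1 exactly when [q ^ 2 < q + 1]: a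
    ratio of 2 would fail, and 4/3 gives the factor 2/3. *)
Definition grid j : R := c * (4 / 3) ^+ j.

Lemma grid_gt0 j : 0 < grid j.
Proof. by rewrite mulr_gt0 // exprn_gt0 // divr_gt0. Qed.

Lemma gridS j : grid j.+1 = 4 / 3 * grid j.
Proof. by rewrite /grid exprS mulrCA. Qed.

Lemma grid_ge j : c <= grid j.
Proof. by rewrite ler_peMr ?(ltW c_gt0) // exprn_ege1 //; lra. Qed.

Lemma grid_large a : exists j, a <= grid j.
Proof.
have q0 : 0 <= 3 / 4 :> R by lra.
have q1 : 3 / 4 < 1 :> R by lra.
have a0 : 0 < c / (1 + `|a|) by rewrite divr_gt0 // ltr_wpDr.
have [j hj] := exprn_le_eps q0 q1 a0.
exists j; move: hj; have -> : (3 / 4 : R) ^+ j = ((4 / 3) ^+ j)^-1.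
  by rewrite -exprVn invf_div.
rewrite ler_pdivlMr; last by rewrite ltr_wpDr.
rewrite ler_pdivrMl; last by rewrite exprn_gt0 // divr_gt0.
by rewrite /grid mulrC; have := ler_norm a; lra.
Qed.

Definition step j x : R := Num.min 1 (Num.max 0 (3 * (x / grid j - 1))).

Lemma cbounded_step j : cbounded (step j).
Proof.
apply: cbounded_clip => x; apply: cvgM; first exact: cvg_cst.
apply: cvgB; last exact: cvg_cst.
by apply: cvgM; [exact: cvg_id | exact: cvg_cst].
Qed.

Lemma step_ge0 j x : 0 <= step j x.
Proof. by rewrite le_min ler01 le_max lexx. Qed.

Lemma step_le1 j x : step j x <= 1.
Proof. by rewrite ge_min lexx. Qed.

Lemma step0 j x : x <= grid j -> step j x = 0.
Proof.
move=> xj; rewrite /step max_l ?min_r // pmulr_rle0 // subr_le0.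
by rewrite ler_pdivrMr ?grid_gt0 // mul1r.
Qed.

Lemma step1 j x : grid j.+1 <= x -> step j x = 1.
Proof.
move=> xj; rewrite /step min_l // le_max; apply/orP; right.
have : 4 / 3 <= x / grid j by rewrite ler_pdivlMr ?grid_gt0 // -gridS.
lra.
Qed.

Lemma step_anti j x : step j.+1 x <= step j x.
Proof.
have [x0|x0] := leP x 0.
  by rewrite !step0 ?(le_trans x0) // ltW // grid_gt0.
rewrite /step le_min ge_min lexx /= ge_min; apply/orP; right.
rewrite ge_max le_max lexx /= le_max; apply/orP; right.
rewrite ler_pM2l // lerD2r ler_wpM2l ?(ltW x0) // lef_pV2 ?posrE ?grid_gt0 //.
by rewrite gridS; have := grid_gt0 j; lra.
Qed.

Definition tent j x := step j x - step j.+1 x.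

Lemma cbounded_tent j : cbounded (tent j).
Proof. by apply: cboundedB; exact: cbounded_step. Qed.

Lemma tent_ge0 j x : 0 <= tent j x.
Proof. by rewrite subr_ge0 step_anti. Qed.

Lemma tent0 j x : x <= grid j \/ grid j.+2 <= x -> tent j x = 0.
Proof.
have jS : grid j <= grid j.+1 by rewrite gridS; have := grid_gt0 j; lra.
have jSS : grid j.+1 <= grid j.+2 by rewrite (gridS j.+1); have := grid_gt0 j.+1; lra.
case=> hx; rewrite /tent.
  by rewrite !step0 ?subrr // (le_trans hx).
by rewrite !step1 ?subrr // (le_trans _ hx).
Qed.

Lemma tent_sum n x : \sum_(j < n) tent j x = step 0 x - step n x.
Proof.
elim: n => [|n ih]; first by rewrite big_ord0 subrr.
by rewrite big_ord_recr ih /= /tent addrA subrK.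
Qed.

Lemma tent_sum_le1 n x : \sum_(j < n) tent j x <= 1.
Proof. by rewrite tent_sum; have := step_ge0 n x; have := step_le1 0 x; lra. Qed.

Definition low n x := step 0 x - step n x.

Lemma cbounded_low n : cbounded (low n).
Proof. by apply: cboundedB; exact: cbounded_step. Qed.

Lemma lowS n x : low n.+1 x = low n x + tent n x.
Proof. by rewrite /low /tent addrA subrK. Qed.

Definition rinv x : R := (Num.max c x)^-1.

Lemma rinv_gt0 x : 0 < rinv x.
Proof. by rewrite invr_gt0 lt_max c_gt0. Qed.

Lemma rinv_le x : rinv x <= c^-1.
Proof. by rewrite lef_pV2 ?posrE // ?le_max ?lexx // lt_max c_gt0. Qed.

Lemma cbounded_rinv : cbounded rinv.
Proof.
split; last by exists c^-1 => x; rewrite gtr0_norm ?rinv_gt0 ?rinv_le.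
move=> x; apply: cvgV; first by rewrite gt_eqF // lt_max c_gt0.
apply: max_fun_continuous; [exact: cst_continuous | by move=> y; exact: cvg_id].
Qed.

(** A bounded continuous version of [x / grid j.+1], exact on the support of [weight j]. *)
Definition ramp j x : R := Num.min (4 / 3) (Num.max 0 (Num.max c x / grid j.+1)).

Lemma ramp_ge0 j x : 0 <= ramp j x.
Proof. by rewrite le_min le_max lexx divr_ge0. Qed.

Lemma ramp_le j x : ramp j x <= 4 / 3.
Proof. by rewrite ge_min lexx. Qed.

Lemma cbounded_ramp j : cbounded (ramp j).
Proof.
apply: cbounded_clip => x; apply: cvgM; last exact: cvg_cst.
apply: max_fun_continuous; [exact: cst_continuous | by move=> y; exact: cvg_id].
Qed.

Lemma rampE j x : c <= x -> x <= grid j.+2 -> ramp j x = x / grid j.+1.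
Proof.
move=> cx xj; have x0 : 0 <= x by rewrite (le_trans (ltW c_gt0)).
rewrite /ramp (max_r cx) max_r ?divr_ge0 ?(ltW (grid_gt0 _)) // min_r //.
by rewrite ler_pdivrMr ?grid_gt0 // -gridS.
Qed.

(** A majorant only, hence free to be discontinuous. For [y] in the support of [tent j], it is of
    the order of [x / y] and carries the decay off the diagonal. *)
Definition weight j x : R :=
  if (c <= x) && (x <= grid j.+2) then x / grid j.+1 else 0.

Lemma rinv_ramp j x h (t : R) : `|h| <= t * weight j x ->
  h = grid j.+1 * (rinv x * (ramp j x * h)).
Proof.
rewrite /weight; case: ifP => [/andP[cx xj] _|_]; last first.
  by rewrite mulr0 normr_le0 => /eqP ->; rewrite !mulr0.
rewrite rampE // /rinv max_r // mulrA [_ * x^-1 as X in X]mulrC; field.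
by rewrite !gt_eqF ?grid_gt0 // (lt_le_trans c_gt0).
Qed.

(** The nonzero terms start at 4/3 or less and decrease with ratio 3/4, so they add up to at most
    16/3. The induction subtracts the tail still to come, which is [4 * (x / grid n.+1)]. *)
Lemma weight_sum n x : \sum_(j < n) weight j x <= 16 / 3.
Proof.
have [cx|cx] := leP c x; last first.
  rewrite big1 ?divr_ge0 // => j _; rewrite /weight leNgt cx //.
suff : \sum_(j < n) weight j x <=
    if x <= grid n.+1 then 16 / 3 - 4 * (x / grid n.+1) else 0.
  case: ifP => _ h; last by rewrite (le_trans h) // divr_ge0.
  have : 0 <= x / grid n.+1.
    by rewrite divr_ge0 ?(ltW (grid_gt0 _)) // (le_trans (ltW c_gt0)).
  lra.
elim: n => [|n ih].
  rewrite big_ord0; case: ifP => // h.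
  have : x / grid 1 <= 1 by rewrite ler_pdivrMr ?grid_gt0 // mul1r.
  lra.
have g1 := grid_gt0 n.+1.
have E : x / grid n.+2 = 3 / 4 * (x / grid n.+1).
  by rewrite (gridS n.+1); field; rewrite gt_eqF.
rewrite big_ord_recr /= {2}/weight cx /=.
move: ih; case: (leP x (grid n.+1)) => h1.
  have -> : x <= grid n.+2 by rewrite (le_trans h1) // (gridS n.+1); lra.
  by rewrite E; lra.
case: (leP x (grid n.+2)) => h2; last by rewrite addr0.
have : x / grid n.+2 <= 1 by rewrite ler_pdivrMr ?grid_gt0 // mul1r.
rewrite E; lra.
Qed.

Lemma tent_rinv j x : 0 < tent j x -> 3 / 4 <= grid j.+1 * rinv x <= 4 / 3.
Proof.
move=> b0; have [xj|xj] := leP x (grid j).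
  by rewrite tent0 ?ltxx // in b0; left.
have [xjj|xjj] := leP (grid j.+2) x.
  by rewrite tent0 ?ltxx // in b0; right.
have x0 : 0 < x by rewrite (lt_trans (grid_gt0 j)).
rewrite /rinv max_r; last by rewrite (le_trans (grid_ge j)) // ltW.
rewrite ler_pdivlMr // ler_pdivrMr //.
by move: xj xjj; rewrite !gridS => xj xjj; apply/andP; split; lra.
Qed.

End Scale.

(** * Inverting the multiplier *)

Section Bilinear.
Context {R : realType} {V : normedModType R[i]}.
Implicit Types (f g : R -> R) (B : (R -> R) -> (R -> R) -> V).

(** [B f g] is the value at a fixed vector of the operator with symbol [f(y) g(x)]: a double
    operator integral restricted to product symbols. The norm of that vector is absorbed in [m]. *)
Record bounded_bilinear (m : R) B : Prop := BoundedBilinear {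
  bilDl : forall f f' g, cbounded f -> cbounded f' -> cbounded g ->
    B (fun x => f x + f' x) g = B f g + B f' g ;
  bilDr : forall f g g', cbounded f -> cbounded g -> cbounded g' ->
    B f (fun x => g x + g' x) = B f g + B f g' ;
  bilZl : forall (a : R) f g, cbounded f -> cbounded g ->
    B (fun x => a * f x) g = a%:C *: B f g ;
  bilZr : forall (a : R) f g, cbounded f -> cbounded g ->
    B f (fun x => a * g x) = a%:C *: B f g ;
  bil_le : forall f g (a b : R), cbounded f -> cbounded g ->
    (forall x, `|f x| <= a) -> (forall x, `|g x| <= b) ->
    rnorm (B f g) <= a * b * m }.

Lemma bounded_bilinear_flip m B : bounded_bilinear m B ->
  bounded_bilinear m (fun f g => B g f).
Proof.
move=> [Dl Dr Zl Zr le]; split=> *; rewrite ?Dl ?Dr ?Zl ?Zr //.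
by rewrite [X in X * m]mulrC le.
Qed.

Context {m : R} {B : (R -> R) -> (R -> R) -> V} (bB : bounded_bilinear m B).

Lemma bilBl f f' g : cbounded f -> cbounded f' -> cbounded g ->
  B (fun x => f x - f' x) g = B f g - B f' g.
Proof.
move=> cf cf' cg; under [in LHS]eq_fun do rewrite -mulN1r.
rewrite (bilDl bB) // ?(bilZl bB) ?rmorphN1 ?scaleN1r //.
exact: cboundedZ.
Qed.

Lemma bilBr f g g' : cbounded f -> cbounded g -> cbounded g' ->
  B f (fun x => g x - g' x) = B f g - B f g'.
Proof.
move=> cf cg cg'; under [in LHS]eq_fun do rewrite -mulN1r.
rewrite (bilDr bB) // ?(bilZr bB) ?rmorphN1 ?scaleN1r //.
exact: cboundedZ.
Qed.

Lemma bil0l g : cbounded g -> B (fun=> 0) g = 0.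
Proof.
move=> cg; have -> : (fun=> 0) = (fun x : R => 0 * (fun=> 0 : R) x).
  by apply/funext => x; rewrite mul0r.
by rewrite (bilZl bB) ?rmorph0 ?scale0r //; exact: cbounded_cst.
Qed.

(* The parallelogram identity
   [B u v + B f g = (B (u + f) (v + g) + B (u - f) (v - g)) / 2]
   turns a sum of values of [B] into an average of single values. *)
Lemma bil_sum_le (I : Type) (s : seq I) (F G : I -> R -> R) (a b : R) :
    (forall i, cbounded (F i)) -> (forall i, cbounded (G i)) ->
    (forall x, \sum_(i <- s) `|F i x| <= a) ->
    (forall x, \sum_(i <- s) `|G i x| <= b) ->
  rnorm (\sum_(i <- s) B (F i) (G i)) <= a * b * m.
Proof.
move=> cF cG hF hG.
(* [u] and [v] collect the terms whose sign is already chosen; the bounds are stable under [u + F i]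
   and [u - F i], so each step averages two instances of the induction hypothesis. *)
suff gen u v : cbounded u -> cbounded v ->
    (forall x, `|u x| + \sum_(i <- s) `|F i x| <= a) ->
    (forall x, `|v x| + \sum_(i <- s) `|G i x| <= b) ->
  rnorm (B u v + \sum_(i <- s) B (F i) (G i)) <= a * b * m.
  rewrite -[\sum_(i <- s) B _ _]add0r -{1}(bil0l (cbounded_cst 0)).
  apply: gen; try exact: cbounded_cst; by move=> x; rewrite normr0 add0r.
elim: s u v {hF hG} => [|i s ih] u v cu cv hu hv.
  rewrite big_nil addr0; apply: (bil_le bB) => // x.
    by have := hu x; rewrite big_nil addr0.
  by have := hv x; rewrite big_nil addr0.
rewrite big_cons addrA.
set S := \sum_(j <- s) _.
have h1 : rnorm (B (fun x => u x + F i x) (fun x => v x + G i x) + S) <= a * b * m.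
  apply: ih; try exact: cboundedD; move=> x.
    by have := hu x; rewrite big_cons; have := ler_normD (u x) (F i x); lra.
  by have := hv x; rewrite big_cons; have := ler_normD (v x) (G i x); lra.
have h2 : rnorm (B (fun x => u x - F i x) (fun x => v x - G i x) + S) <= a * b * m.
  apply: ih; try exact: cboundedB; move=> x.
    by have := hu x; rewrite big_cons; have := ler_normB (u x) (F i x); lra.
  by have := hv x; rewrite big_cons; have := ler_normB (v x) (G i x); lra.
have E : (B (fun x => u x + F i x) (fun x => v x + G i x) + S) +
    (B (fun x => u x - F i x) (fun x => v x - G i x) + S) =
    (2%:R : R)%:C *: (B u v + B (F i) (G i) + S).
  rewrite bilBl ?(bilDl bB) //; try exact: cboundedD; try exact: cboundedB.
  rewrite !bilBr // !(bilDr bB) // rmorph_nat scaler_nat mulr2n addrACA.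
  rewrite [RHS]addrACA; congr (_ + _).
  rewrite opprB [B u v + B u (G i) + _]addrACA.
  have -> : B u v - B u (G i) + (B (F i) (G i) - B (F i) v) =
    B u v + B (F i) (G i) - (B u (G i) + B (F i) v) by rewrite addrACA -opprD.
  rewrite [B u (G i) + B (F i) (G i)]addrC.
  have -> : B u v + B (F i) v + (B (F i) (G i) + B u (G i)) =
    B u v + B (F i) (G i) + (B u (G i) + B (F i) v).
    by rewrite addrACA [B (F i) v + _]addrC.
  by rewrite addrACA subrr addr0.
have := rnormD (B (fun x => u x + F i x) (fun x => v x + G i x) + S)
  (B (fun x => u x - F i x) (fun x => v x - G i x) + S).
rewrite E rnormZr normr_nat; lra.
Qed.

End Bilinear.

Section SchurMultiplier.
Context {R : realType} {V : normedModType R[i]} {c : R} (c_gt0 : 0 < c).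
Implicit Types (f g h : R -> R) (x : R) (j n : nat).
Context {m e : R} {B K : (R -> R) -> (R -> R) -> V}.
Context (bB : bounded_bilinear m B) (bK : bounded_bilinear e K).
Hypotheses (m_ge0 : 0 <= m) (e_ge0 : 0 <= e).
Hypothesis rel : forall f g, cbounded f -> cbounded g ->
  B f (fun x => rinv (c := c) x * g x) + B (fun x => rinv (c := c) x * f x) g =
  K (fun x => rinv (c := c) x * f x) g.

Local Notation grid := (@grid R c).
Local Notation tent := (@tent R c).
Local Notation rinv := (@rinv R c).
Local Notation ramp := (@ramp R c).
Local Notation weight := (@weight R c).
Local Notation low := (@low R c).

Let scaled j f x := grid j.+1 * (rinv x * f x).

Let cbounded_scaled j f : cbounded f -> cbounded (scaled j f).
Proof. by move=> cf; apply/cboundedZ/cboundedM => //; exact: cbounded_rinv. Qed.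

Let cbounded_ramped j f : cbounded f -> cbounded (fun x => ramp j x * f x).
Proof. by move=> cf; apply/cboundedM => //; exact: cbounded_ramp. Qed.

(** [scaled j] multiplies by [grid j.+1 / y] and [ramp j] by [x / grid j.+1], so the two together
    multiply by [x / y], written as a product symbol: this is [(1 + x / y) B = (x / y) K]. The bound
    on [h] confines it to where [ramp j] is exact. *)
Lemma scaled_relation j f h (t : R) : cbounded f -> cbounded h ->
    (forall x, `|h x| <= t * weight j x) ->
  B f h + B (scaled j f) (fun x => ramp j x * h x) =
  K (scaled j f) (fun x => ramp j x * h x).
Proof.
move=> cf ch hw; have cr := cbounded_rinv c_gt0.
have {1}-> : h = fun x => grid j.+1 * (rinv x * (ramp j x * h x)).
  by apply/funext => x; exact: (rinv_ramp c_gt0 (hw x)).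
have cah := cbounded_ramped j ch.
rewrite (bilZr bB) ?(bilZl bB) ?(bilZl bK) //; try by exact: cboundedM.
by rewrite -scalerDr rel.
Qed.

Let scaled_le j f (s : R) x : 0 <= s -> `|f x| <= s * tent j x ->
  `|scaled j f x| <= 4 / 3 * s * tent j x /\
  `|scaled j f x - f x| <= 3^-1 * s * tent j x.
Proof.
move=> s0; have [b0|b0] := ltP 0 (tent j x); last first.
  have -> : tent j x = 0 by apply/le_anti; rewrite b0 tent_ge0.
  by rewrite !mulr0 /scaled normr_le0 => /eqP ->; rewrite !mulr0 subrr normr0.
have /andP[h1 h2] := tent_rinv c_gt0 b0.
rewrite /scaled mulrA -[X in _ - X]mul1r -mulrBl => fx.
rewrite ![`|_ * f x|]normrM [`|grid _ * _|]ger0_norm; last lra.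
have h3 : `|grid j.+1 * rinv x - 1| <= 3^-1 by rewrite ler_norml; lra.
by split; rewrite -mulrA ler_pM //; lra.
Qed.

Let ramped_le j h (t : R) x : `|h x| <= t * weight j x ->
  `|ramp j x * h x| <= 4 / 3 * t * weight j x /\
  `|(ramp j x - 2 / 3) * h x| <= 2 / 3 * t * weight j x.
Proof.
move=> hx; have a0 := ramp_ge0 (c := c) j x; have a1 := ramp_le (c := c) j x.
rewrite !normrM -![_ * t * _]mulrA.
by split; apply: ler_pM => //; rewrite ler_norml; lra.
Qed.

Let sum_tight (s : R) n (F : nat -> R -> R) x : 0 <= s ->
  (forall j y, `|F j y| <= s * tent j y) -> \sum_(j < n) `|F j x| <= s.
Proof.
move=> s0 hF; apply: (@le_trans _ _ (\sum_(j < n) s * tent j x)).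
  by apply: ler_sum.
by rewrite -mulr_sumr ler_piMr // tent_sum_le1.
Qed.

Let sum_loose (t : R) n (H : nat -> R -> R) x : 0 <= t ->
  (forall j y, `|H j y| <= t * weight j y) -> \sum_(j < n) `|H j x| <= t * (16 / 3).
Proof.
move=> t0 hH; apply: (@le_trans _ _ (\sum_(j < n) t * weight j x)).
  by apply: ler_sum.
by rewrite -mulr_sumr ler_wpM2l // weight_sum.
Qed.

(* The factor [1 + x / y] relating [K] to [B], with [x / y] in [0, 4/3] up to
   the width of the tents, is inverted by a Neumann series around [5/3]. *)
Lemma diagonal_sum_le_iter k n (F H : nat -> R -> R) (s t : R) :
    0 <= s -> 0 <= t ->
    (forall j, cbounded (F j)) -> (forall j, cbounded (H j)) ->
    (forall j x, `|F j x| <= s * tent j x) ->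
    (forall j x, `|H j x| <= t * weight j x) ->
  rnorm (\sum_(j < n) B (F j) (H j)) <=
    s * t * (256 / 15 * e + (2 / 3) ^+ k * (16 / 3 * m)).
Proof.
elim: k F H s t => [|k ih] F H s t s0 t0 cF cH hF hH.
  have : rnorm (\sum_(j < n) B (F j) (H j)) <= s * (t * (16 / 3)) * m.
    apply: (bil_sum_le bB (F := fun j : 'I_n => F j) (G := fun j : 'I_n => H j)).
    - by move=> j; exact: cF.
    - by move=> j; exact: cH.
    - by move=> x; exact: sum_tight.
    - by move=> x; exact: sum_loose.
  rewrite expr0; have : 0 <= s * t * e by rewrite !mulr_ge0.
  lra.
pose aH j x := ramp j x * H j x.
have caH j : cbounded (aH j) by exact: cbounded_ramped.
have haH j x : `|aH j x| <= 4 / 3 * t * weight j x.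
  by have [] := ramped_le (hH j x).
have cgF j : cbounded (scaled j (F j)) by exact: cbounded_scaled.
have hgF j x : `|scaled j (F j) x| <= 4 / 3 * s * tent j x.
  by have [] := scaled_le s0 (hF j x).
have s0' : 0 <= 4 / 3 * s by rewrite mulr_ge0.
have t0' : 0 <= 4 / 3 * t by rewrite mulr_ge0.
have hK : rnorm (\sum_(j < n) K (scaled j (F j)) (aH j)) <=
    4 / 3 * s * (4 / 3 * t * (16 / 3)) * e.
  apply: (bil_sum_le bK (F := fun j : 'I_n => scaled j (F j))
    (G := fun j : 'I_n => aH j)).
  - by move=> j; exact: cgF.
  - by move=> j; exact: caH.
  - by move=> x; apply: (@sum_tight _ n (fun j => scaled j (F j)) x).
  - by move=> x; apply: (@sum_loose _ n aH x).
have h1 := ih F (fun j x => (ramp j x - 2 / 3) * H j x) s (2 / 3 * t).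
have {}h1 : rnorm (\sum_(j < n) B (F j) (fun x => (ramp j x - 2 / 3) * H j x)) <=
    s * (2 / 3 * t) * (256 / 15 * e + (2 / 3) ^+ k * (16 / 3 * m)).
  apply: h1 => //; first by rewrite mulr_ge0.
    move=> j; apply: cboundedM => //.
    by apply: cboundedB; [exact: cbounded_ramp | exact: cbounded_cst].
  by move=> j x; have [] := ramped_le (hH j x).
have h2 := ih (fun j x => scaled j (F j) x - F j x) aH (3^-1 * s) (4 / 3 * t).
have {}h2 : rnorm (\sum_(j < n) B (fun x => scaled j (F j) x - F j x) (aH j)) <=
    3^-1 * s * (4 / 3 * t) * (256 / 15 * e + (2 / 3) ^+ k * (16 / 3 * m)).
  apply: h2 => //; first by rewrite mulr_ge0.
    by move=> j; exact: cboundedB.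
  by move=> j x; have [] := scaled_le s0 (hF j x).
(* The error [x / y - 2 / 3] splits into [ramp - 2 / 3], of size 2/3, and [ramp] times the relative
   width of the tent, of size [4 / 3 * 1 / 3]. In all 10/9, and divided by 5/3 this is the ratio
   2/3. The constant 256/15 is the fixed point of [5 / 3 * u = 256 / 27 + 10 / 9 * u]. *)
have E : (5 / 3)%:C *: (\sum_(j < n) B (F j) (H j)) =
    \sum_(j < n) K (scaled j (F j)) (aH j)
    - \sum_(j < n) B (F j) (fun x => (ramp j x - 2 / 3) * H j x)
    - \sum_(j < n) B (fun x => scaled j (F j) x - F j x) (aH j).
  rewrite scaler_sumr -!sumrB; apply: eq_bigr => j _.
  have cr : cbounded (fun x => (2 / 3) * H j x) by exact: cboundedZ.
  have -> : (fun x => (ramp j x - 2 / 3) * H j x) =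
      fun x => aH j x - 2 / 3 * H j x by apply/funext => x; rewrite mulrBl.
  rewrite (bilBl bB) // (bilBr bB) // (bilZr bB) // -(scaled_relation _ _ (hH j)) //.
  have -> : (5 / 3 : R) = 1 + 2 / 3 by lra.
  rewrite rmorphD scalerDl scale1r !opprB -[RHS]addrA.
  by rewrite [X in _ = _ + X]addrA subrK addrACA subrr addr0.
have := rnormB (\sum_(j < n) K (scaled j (F j)) (aH j)
    - \sum_(j < n) B (F j) (fun x => (ramp j x - 2 / 3) * H j x))
  (\sum_(j < n) B (fun x => scaled j (F j) x - F j x) (aH j)).
have := rnormB (\sum_(j < n) K (scaled j (F j)) (aH j))
  (\sum_(j < n) B (F j) (fun x => (ramp j x - 2 / 3) * H j x)).
rewrite -E rnormZr ger0_norm // exprS.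
set p := (2 / 3) ^+ k; rewrite -/p in h1 h2.
lra.
Qed.

Lemma diagonal_sum_le n (F H : nat -> R -> R) (s t : R) :
    0 <= s -> 0 <= t ->
    (forall j, cbounded (F j)) -> (forall j, cbounded (H j)) ->
    (forall j x, `|F j x| <= s * tent j x) ->
    (forall j x, `|H j x| <= t * weight j x) ->
  rnorm (\sum_(j < n) B (F j) (H j)) <= s * t * (256 / 15 * e).
Proof.
move=> s0 t0 cF cH hF hH; apply/ler_addgt0Pr => a a0.
have b0 : 0 <= s * t * (16 / 3 * m) by rewrite !mulr_ge0.
have q0 : 0 <= 2 / 3 :> R by lra.
have q1 : 2 / 3 < 1 :> R by lra.
have c0 : 0 < a / (1 + s * t * (16 / 3 * m)) by rewrite divr_gt0 // ltr_wpDr.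
have [k hk] := exprn_le_eps q0 q1 c0.
rewrite (le_trans (diagonal_sum_le_iter k n s0 t0 cF cH hF hH)) //.
move: hk; rewrite ler_pdivlMr ?ltr_wpDr // mulrDr mulr1.
have := exprn_ge0 k q0; lra.
Qed.

(** The functions [L j] are bounded but have no bounded sum, so [diagonal_sum_le] does not apply to
    them directly. A single use of the relation replaces [L j] by [ramp j * L j], which [weight j]
    dominates. *)
Lemma one_sided_sum_le n (L : nat -> R -> R) : (forall j, cbounded (L j)) ->
    (forall j x, `|L j x| <= if (c <= x) && (x <= grid j.+2) then 1 else 0) ->
  rnorm (\sum_(j < n) B (tent j) (L j)) <= 30 * e.
Proof.
move=> cL hL; pose T j := scaled j (tent j); pose M j x := ramp j x * L j x.
have c43 : 0 <= 4 / 3 :> R by lra.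
have cT j : cbounded (T j) by apply: cbounded_scaled; exact: cbounded_tent.
have cM j : cbounded (M j) by exact: cbounded_ramped.
have hT j x : `|T j x| <= 4 / 3 * tent j x.
  have [|+ _] := @scaled_le j (tent j) 1 x ler01; last by rewrite mulr1.
  by rewrite mul1r ger0_norm // tent_ge0.
have hM j x : `|M j x| <= 1 * weight j x.
  have := hL j x; rewrite /M /weight mul1r; case: ifP => [/andP[cx xj]|_].
    have x0 : 0 <= x / grid j.+1.
      by rewrite divr_ge0 ?(le_trans (ltW c_gt0) cx) ?(ltW (grid_gt0 c_gt0 _)).
    by move=> h; rewrite rampE // normrM ger0_norm // ler_piMr.
  by rewrite normr_le0 => /eqP ->; rewrite mulr0 normr0.
(* This crude constant only gives access to [scaled_relation] and does not enter the bound. *)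
have hL' j x : `|L j x| <= grid j.+1 / c * weight j x.
  have := hL j x; rewrite /weight; case: ifP => [/andP[cx xj]|_]; last first.
    by rewrite mulr0.
  move=> h; rewrite (le_trans h) //.
  have -> : grid j.+1 / c * (x / grid j.+1) = x / c.
    by field; rewrite !gt_eqF // grid_gt0.
  by rewrite ler_pdivlMr // mul1r.
have -> : \sum_(j < n) B (tent j) (L j) =
    \sum_(j < n) K (T j) (M j) - \sum_(j < n) B (T j) (M j).
  rewrite -sumrB; apply: eq_bigr => j _.
  rewrite -(scaled_relation _ _ (hL' j)) ?addrK //; exact: cbounded_tent.
(* The two parts give [64 / 9 * e] and [4 / 3 * (256 / 15) * e], together less than [30 * e]. *)
rewrite (le_trans (rnormB _ _)) //.
have := @diagonal_sum_le n T M (4 / 3) 1 c43 ler01 cT cM hT hM.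
have : rnorm (\sum_(j < n) K (T j) (M j)) <= 4 / 3 * (1 * (16 / 3)) * e.
  apply: (bil_sum_le bK (F := fun j : 'I_n => T j) (G := fun j : 'I_n => M j)).
  - by move=> j; exact: cT.
  - by move=> j; exact: cM.
  - by move=> x; exact: (@sum_tight _ n T x).
  - by move=> x; exact: (@sum_loose _ n M x).
move: e_ge0 (rnorm _) (rnorm _) => ? u v; lra.
Qed.

End SchurMultiplier.

Section Paraproduct.
Context {R : realType} {V : normedModType R[i]} {c : R} (c_gt0 : 0 < c).
Context {m e : R} {B K1 K2 : (R -> R) -> (R -> R) -> V}.
Context (bB : bounded_bilinear m B).
Context (bK1 : bounded_bilinear e K1) (bK2 : bounded_bilinear e K2).
Hypotheses (m_ge0 : 0 <= m) (e_ge0 : 0 <= e).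
Local Notation rinv := (@rinv R c).
Local Notation grid := (@grid R c).
Local Notation tent := (@tent R c).
Local Notation low := (@low R c).
Hypothesis rel1 : forall f g, cbounded f -> cbounded g ->
  B f (fun x => rinv x * g x) + B (fun x => rinv x * f x) g =
  K1 (fun x => rinv x * f x) g.
Hypothesis rel2 : forall f g, cbounded f -> cbounded g ->
  B f (fun x => rinv x * g x) + B (fun x => rinv x * f x) g =
  K2 f (fun x => rinv x * g x).

(* [low n (x) low n] is split into [sum_j tent j (x) low j.+1], where [K1] is a
   good approximate inverse, and [sum_j low j (x) tent j], where [K2] is. *)
Lemma paraproduct_le n : rnorm (B (low n) (low n)) <= 60 * e.
Proof.
have cl j : cbounded (low j) by exact: cbounded_low.
have ct j : cbounded (tent j) by exact: cbounded_tent.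
have hl j x : `|low j x| <=
    if (c <= x) && (x <= grid j.+1) then 1 else 0.
  have s0 := step_ge0 (c := c) 0 x; have s1 := step_le1 (c := c) 0 x.
  have t0 := step_ge0 (c := c) j x; have t1 := step_le1 (c := c) j x.
  case: ifP => [_|/negbT]; first by rewrite ler_norml /low; lra.
  rewrite negb_and -!ltNge => /orP[xc|xj]; rewrite normr_le0 /low.
    rewrite !step0 ?subrr ?eqxx //; last by rewrite /grid mulr1 ltW.
    by rewrite (le_trans (ltW xc)) // grid_ge.
  rewrite [X in _ - X]step1 ?(ltW xj) // step1 ?subrr ?eqxx //.
  rewrite (le_trans _ (ltW xj)) // !gridS ler_pM2l //.
  by rewrite /grid expr0 mulr1 grid_ge.
(* Passing from [n] to [n.+1] adds [tent n (x) low n.+1] and [low n (x) tent n]; the shifted index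
   counts the diagonal block once. *)
have E : B (low n) (low n) =
    \sum_(j < n) B (tent j) (low j.+1) + \sum_(j < n) B (low j) (tent j).
  elim: n => [|n ih].
    have -> : low 0 = fun=> 0 by apply/funext => x; rewrite /low subrr.
    by rewrite !big_ord0 addr0 (bil0l bB) //; exact: cbounded_cst.
  have E : low n.+1 = fun x => low n x + tent n x.
    by apply/funext => x; rewrite lowS.
  rewrite {1}E (bilDl bB) // {1}E (bilDr bB) // ih !big_ord_recr /=.
  by rewrite -[LHS]addrA [X in _ + X = _]addrC addrACA.
rewrite E (le_trans (rnormD _ _)) //.
have h1 : rnorm (\sum_(j < n) B (tent j) (low j.+1)) <= 30 * e.
  by apply: (one_sided_sum_le c_gt0 bB bK1 m_ge0 e_ge0 rel1 n
    (L := fun j => low j.+1)) => // j x; exact: hl.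
have h2 : rnorm (\sum_(j < n) B (low j) (tent j)) <= 30 * e.
  have rel2' f g : cbounded f -> cbounded g ->
      B (fun x => rinv x * g x) f + B g (fun x => rinv x * f x) =
      K2 g (fun x => rinv x * f x).
    by move=> cf cg; rewrite addrC rel2.
  apply: (one_sided_sum_le c_gt0 (bounded_bilinear_flip bB)
    (bounded_bilinear_flip bK2) m_ge0 e_ge0 rel2' n (L := low)) => // j x.
  rewrite (le_trans (hl j x)) //; case: ifP => [/andP[-> xj]|_] /=; last by case: ifP.
  suff -> : x <= grid j.+2 by [].
  by rewrite (le_trans xj) // (gridS j.+1) ler_peMl ?(ltW (grid_gt0 c_gt0 _)) //; lra.
lra.
Qed.

End Paraproduct.

(** * Products of spectral projections *)

Section RealCalculus.
Context {R : realType} {A : cstarAlgType R} {E : hilbertModType A}.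
Context {c : R} (c_gt0 : 0 < c).
Implicit Types (f g : R -> R) (x : R) (phi : (R -> R) -> E -> E) (z xi : E).
Local Notation grid := (@grid R c).
Local Notation rinv := (@rinv R c).
Local Notation step := (@step R c).
Local Notation low := (@low R c).

(** Of the spectrum only the gap [|x| < grid 1] is retained. These properties survive the reflection
    of the line, so they cover [- T] along with [T]. *)
Record real_calculus phi : Prop := RealCalculus {
  cal_eq : forall f g, cbounded f -> cbounded g ->
    (forall x, grid 1 <= `|x| -> f x = g x) -> phi f =1 phi g ;
  calD : forall f g z, cbounded f -> cbounded g ->
    phi (fun x => f x + g x) z = phi f z + phi g z ;
  calZ : forall (a : R) f z, cbounded f ->
    phi (fun x => a * f x) z = a%:C *: phi f z ;
  calM : forall f g z, cbounded f -> cbounded g ->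
    phi (fun x => f x * g x) z = phi f (phi g z) ;
  cal1 : forall z, phi (fun=> 1) z = z ;
  cal_adj : forall f, cbounded f -> adjoint_pair (phi f) (phi f) ;
  cal_le : forall f (a : R), cbounded f ->
    (forall x, grid 1 <= `|x| -> `|f x| <= a) -> bounded_by a (phi f) }.

Lemma grid_mono i j : (i <= j)%N -> grid i <= grid j.
Proof.
by move=> ij; rewrite /grid ler_pM2l // ler_weXn2l //; lra.
Qed.

Lemma step_support j x : grid 1 <= `|x| -> step j x != 0 -> grid 1 <= x.
Proof.
have [x0|x0] := leP 0 x; first by rewrite ger0_norm.
by rewrite step0 ?eqxx // (le_trans (ltW x0)) // ltW // grid_gt0.
Qed.

Lemma step0_idem x : grid 1 <= `|x| -> step 0 x * step 0 x = step 0 x.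
Proof.
move=> x1; have [->|s0] := eqVneq (step 0 x) 0; first by rewrite mulr0.
by rewrite step1 ?mulr1 //; exact: step_support s0.
Qed.

(** * Spectral cut-offs at infinity *)

Section Strong.
Context {phi} (cphi : real_calculus phi) {beta : R -> R}.
Hypotheses (cbeta : cbounded beta).
Hypothesis beta_inv : forall x, grid 1 <= x -> `|beta x| = x^-1.
Hypothesis beta_dense : dense (range (phi beta)).

Lemma calB f g z : cbounded f -> cbounded g ->
  phi (fun x => f x - g x) z = phi f z - phi g z.
Proof.
move=> cf cg; under [in LHS]eq_fun do rewrite -mulN1r.
rewrite (calD cphi) // ?(calZ cphi) ?rmorphN1 ?scaleN1r //; exact: cboundedZ.
Qed.

(** On the dense range of [phi beta] the product [step j * beta] is at most [(grid j)^-1]; elsewhere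
    one approximates, the cut-offs being contractions. *)
Lemma step_strong z (e : R) : 0 < e ->
  exists J, forall j, (J <= j)%N -> rnorm (phi (step j) z) <= e.
Proof.
move=> e0; have e20 : 0 < e / 2 by rewrite divr_gt0.
have [_ [y _ <-] zy] := dense_rnorm z beta_dense e20.
have [J hJ] := grid_large c_gt0 (2 * rnorm y / e).
exists J => j Jj; have cs := cbounded_step (c := c) j.
have g0 := grid_gt0 c_gt0 j.
have gj : 2 * rnorm y / e <= grid j by rewrite (le_trans hJ) // grid_mono.
rewrite -(subrK (phi beta y) z) (adjoint_pair_add (cal_adj cphi cs)).
rewrite (le_trans (rnormD _ _)) // -(calM cphi) //.
have h1 : rnorm (phi (step j) (z - phi beta y)) <= 1 * rnorm (z - phi beta y).
  apply: (cal_le cphi) => // x _.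
  by rewrite ger0_norm ?step_le1 ?step_ge0.
have h2 : rnorm (phi (fun x => step j x * beta x) y) <= (grid j)^-1 * rnorm y.
  apply: (cal_le cphi) => [|x x1]; first exact: cboundedM.
  have [->|s0] := eqVneq (step j x) 0.
    by rewrite mul0r normr0 invr_ge0 ltW.
  rewrite normrM beta_inv; last exact: step_support s0.
  have [xj|xj] := leP x (grid j); first by rewrite step0 ?eqxx in s0.
  rewrite ger0_norm ?step_ge0 // (le_trans (ler_piMl _ (step_le1 j x))) //.
    by rewrite invr_ge0 (le_trans _ (ltW xj)) // ltW.
  by rewrite lef_pV2 ?posrE ?(lt_trans _ xj) // ltW.
have h3 : (grid j)^-1 * rnorm y <= e / 2.
  rewrite ler_pdivrMl //; move: gj; rewrite ler_pdivrMr //; lra.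
move: zy h1 h2; lra.
Qed.

(** For a rank-one operator the self-adjoint cut-off moves onto the vector [eta], where strong
    convergence applies; finite sums and norm limits follow. *)
Lemma compact_step_small (k : E -> E) (e : R) : compact_operator k -> 0 < e ->
  exists J, forall j, (J <= j)%N -> bounded_by e (k \o phi (step j)).
Proof.
move=> /compact_operatorP ck e0; have e20 : 0 < e / 2 by rewrite divr_gt0.
have [F /rank_one_spanP[s ->] hF] := ck _ e20.
suff [J hJ] : exists J, forall j, (J <= j)%N -> bounded_by (e / 2)
    (fun z => \sum_(t <- s) t.1.1 *: rank_one t.1.2 t.2 (phi (step j) z)).
  exists J => j Jj z /=; have := hJ j Jj z; have := hF (phi (step j) z).
  have : rnorm (phi (step j) z) <= 1 * rnorm z.
    apply: (cal_le cphi) => [|x _]; first exact: cbounded_step.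
    by rewrite ger0_norm ?step_le1 ?step_ge0.
  set S := \sum_(t <- s) _.
  have := rnormD (k (phi (step j) z) - S) S; rewrite subrK /=; nra.
elim: s {hF} (e / 2) e20 => [|[[a psi] eta] s ih] {e0}e e0.
  by exists 0%N => j _ z; rewrite big_nil rnorm0 mulr_ge0 ?rnorm_ge0 ?ltW.
have e20 : 0 < e / 2 by rewrite divr_gt0.
have [J hJ] := ih (e / 2) e20.
pose M := complex.Re `|a| * (4 * rnorm psi).
have M0 : 0 <= M.
  by rewrite !mulr_ge0 ?rnorm_ge0 // -lecR RRe_real ?normr_real // normr_ge0.
have [|J' hJ'] := step_strong eta (e := e / 2 / (1 + M)).
  by rewrite divr_gt0 // ltr_wpDr.
exists (maxn J J') => j; rewrite geq_max => /andP[Jj J'j] z.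
rewrite big_cons (le_trans (rnormD _ _)) //=.
have := hJ j Jj z; have := hJ' j J'j; rewrite ler_pdivlMr ?ltr_wpDr //.
have -> : rank_one psi eta (phi (step j) z) = rank_one psi (phi (step j) eta) z.
  by rewrite /rank_one (cal_adj cphi (cbounded_step (c := c) j)).
have h1 : rnorm (a *: rank_one psi (phi (step j) eta) z) <=
    M * rnorm (phi (step j) eta) * rnorm z.
  rewrite rnormZ /M -!mulrA ler_wpM2l //.
    by rewrite -lecR RRe_real ?normr_real // normr_ge0.
  by rewrite !mulrA rnorm_rank_one.
move=> h2 h3; rewrite (le_trans (lerD h1 h3)) //.
have h4 : M * rnorm (phi (step j) eta) <= e / 2.
  by have := rnorm_ge0 (phi (step j) eta); lra.
have := ler_wpM2r (rnorm_ge0 z) h4; lra.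
Qed.

End Strong.

(** * Compactness of the product of two positive projections *)

Section Core.
Context {phi psi : (R -> R) -> E -> E} {beta gamma : R -> R} {k l : E -> E}.
Hypotheses (cphi : real_calculus phi) (cpsi : real_calculus psi).
Hypotheses (cbeta : cbounded beta) (cgamma : cbounded gamma).
Hypothesis beta_inv : forall x, grid 1 <= x -> beta x = x^-1.
Hypothesis gamma_inv : forall x, grid 1 <= x -> gamma x = - x^-1.
Hypothesis beta_dense : dense (range (phi beta)).
Hypothesis gamma_dense : dense (range (psi gamma)).
Hypotheses (ck : compact_operator k) (cl : compact_operator l).
Hypothesis resolvent_k : forall z, phi beta z = psi gamma (z + k z).
Hypothesis resolvent_l : forall z, psi gamma z = phi beta z - l (phi beta z).

(** This is [psi f X phi (t g)] for [X = psi (step 0) phi (step 0)]. The cut-off [t] is [step j] for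
    large values of [T], making [k] and [l] small, and 1 for the bounded part. *)
Let form (t : R -> R) (f g : R -> R) (z : E) : E :=
  psi (fun x => step 0 x * f x) (phi (fun x => step 0 x * (t x * g x)) z).

Let cs0 f : cbounded f -> cbounded (fun x => step 0 x * f x).
Proof. by apply: cboundedM; exact: cbounded_step. Qed.

Let step0_norm f (a : R) x : `|f x| <= a -> `|step 0 x * f x| <= a.
Proof.
move=> fa; rewrite normrM (le_trans _ fa) // ler_piMl //.
by rewrite ger0_norm ?step_ge0 ?step_le1.
Qed.

Let rinvE x : grid 1 <= x -> rinv x = x^-1.
Proof.
move=> x1; rewrite /rinv max_r // (le_trans _ x1) //; exact: grid_ge.
Qed.

Lemma phi_rinv g z : cbounded g ->
  phi (fun x => step 0 x * (rinv x * g x)) z =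
  phi beta (phi (fun x => step 0 x * g x) z).
Proof.
move=> cg; have cr := cbounded_rinv c_gt0; have cg' := cs0 cg.
rewrite -(calM cphi) //; apply: (cal_eq cphi).
- by apply/cs0/cboundedM.
- exact: cboundedM.
move=> x x1; have [->|s0] := eqVneq (step 0 x) 0; first by rewrite !mul0r mulr0.
have {}x1 := step_support x1 s0; rewrite rinvE // beta_inv //; ring.
Qed.

(** On the support of [step 0] outside the gap, [rinv] is [1 / x] and [gamma] is its opposite. This
    sign makes the two terms of the relations below combine into the difference of the two
    inverses. *)
Lemma psi_rinv f z : cbounded f ->
  psi (fun x => step 0 x * (rinv x * f x)) z =
  - psi (fun x => step 0 x * f x) (psi gamma z).
Proof.
move=> cf; have cr := cbounded_rinv c_gt0; have cf' := cs0 cf.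
rewrite -(calM cpsi) // -scaleN1r -[-1](rmorphN1 (real_complex R)).
rewrite -(calZ cpsi); last exact: cboundedM.
apply: (cal_eq cpsi).
- by apply/cs0/cboundedM.
- by apply/cboundedZ/cboundedM.
move=> x x1; have [->|s0] := eqVneq (step 0 x) 0; first by rewrite !mul0r mulr0.
have {}x1 := step_support x1 s0; rewrite rinvE // gamma_inv //; ring.
Qed.

Let form_arg (t g : R -> R) :
  (fun x => step 0 x * (t x * (rinv x * g x))) =
  (fun x => step 0 x * (rinv x * (t x * g x))).
Proof. by apply/funext => x; congr (_ * _); rewrite mulrCA. Qed.

(** By [phi_rinv] and [psi_rinv] the left side is [psi f (b - b') phi (t g)], cut off by [step 0],
    with [b = phi beta] and [b' = psi gamma]. Here [b - b' = b' k], and [b'] is absorbed by [psi] as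
    [- 1 / y]. The companion relation uses [b - b' = l b] and absorbs [b] on the right. *)
Lemma form_rel_k t f g z : cbounded t -> cbounded f -> cbounded g ->
  form t f (fun x => rinv x * g x) z + form t (fun x => rinv x * f x) g z =
  - psi (fun x => step 0 x * (rinv x * f x))
      (k (phi (fun x => step 0 x * (t x * g x)) z)).
Proof.
move=> ct cf cg; rewrite /form.
rewrite (form_arg t g) phi_rinv; last exact: cboundedM.
set w := phi _ z.
rewrite !psi_rinv // resolvent_k opprK.
rewrite (adjoint_pair_add (cal_adj cpsi cgamma)).
by rewrite (adjoint_pair_add (cal_adj cpsi (cs0 cf))) addrAC subrr add0r.
Qed.

Lemma form_rel_l t f g z : cbounded t -> cbounded f -> cbounded g ->
  form t f (fun x => rinv x * g x) z + form t (fun x => rinv x * f x) g z =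
  psi (fun x => step 0 x * f x)
      (l (phi (fun x => step 0 x * (t x * (rinv x * g x))) z)).
Proof.
move=> ct cf cg; rewrite /form.
rewrite (form_arg t g) phi_rinv; last exact: cboundedM.
set w := phi _ z.
rewrite psi_rinv // resolvent_l (adjoint_pair_sub (cal_adj cpsi (cs0 cf))).
by rewrite opprB addrC subrK.
Qed.

(* [K] stands for the identity, [k] or [l]. *)
Lemma form_bounded_bilinear t K K' (e : R) z : 0 <= e ->
    cbounded t -> adjoint_pair K K' -> bounded_by e (K \o phi t) ->
  bounded_bilinear (e * rnorm z) (fun f g => psi (fun x => step 0 x * f x)
    (K (phi (fun x => step 0 x * (t x * g x)) z))).
Proof.
move=> e0 ct KK' Ke; split.
- move=> f f' g cf cf' cg; rewrite -(calD cpsi) //; try exact: cs0.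
  by congr (psi _ _); apply/funext => x; rewrite mulrDr.
- move=> f g g' cf cg cg'.
  rewrite -(adjoint_pair_add (cal_adj cpsi (cs0 cf))) -(adjoint_pair_add KK').
  rewrite -(calD cphi); try by apply/cs0/cboundedM.
  by congr (psi _ (K (phi _ _))); apply/funext => x; rewrite !mulrDr.
- move=> a f g cf cg; rewrite -(calZ cpsi) //; last exact: cs0.
  by congr (psi _ _); apply/funext => x; rewrite mulrCA.
- move=> a f g cf cg.
  rewrite -(adjoint_pair_scale (cal_adj cpsi (cs0 cf))) -(adjoint_pair_scale KK').
  rewrite -(calZ cphi); last by apply/cs0/cboundedM.
  congr (psi _ (K (phi _ _))); apply/funext => x; ring.
- move=> f g a b cf cg fa gb.
  have a0 : 0 <= a by rewrite (le_trans (normr_ge0 _) (fa 0)).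
  rewrite (le_trans (@cal_le _ cpsi _ a _ _ _)) //; first exact: cs0.
    by move=> x _; exact: step0_norm.
  rewrite -mulrA ler_wpM2l //.
  have -> : (fun x => step 0 x * (t x * g x)) = fun x => t x * (step 0 x * g x).
    by apply/funext => x; rewrite mulrCA.
  have cg' := cs0 cg.
  rewrite (calM cphi) // (le_trans (Ke _)) // mulrCA.
  rewrite ler_wpM2l // (@cal_le _ cphi _ b _ _ _) // => x _.
  exact: step0_norm.
Qed.

Let step_bounded f z (a : R) : cbounded f ->
  (forall x, `|f x| <= a) -> rnorm (phi f z) <= a * rnorm z.
Proof. by move=> cf fa; apply: (cal_le cphi). Qed.

Let cstep j : cbounded (step j) := cbounded_step (c := c) j.

Let step_norm j x : `|step j x| <= 1.
Proof. by rewrite ger0_norm ?step_ge0 ?step_le1. Qed.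

Lemma form_id_bounded t z : cbounded t -> (forall x, `|t x| <= 1) ->
  bounded_bilinear (1 * rnorm z) (fun f g => form t f g z).
Proof.
move=> ct t1; apply: (@form_bounded_bilinear t idfun idfun 1 z) => //.
by move=> y /=; exact: step_bounded.
Qed.

Lemma form_low_le j (e : R) n z : 0 <= e ->
    bounded_by e (k \o phi (step j)) -> bounded_by e (l \o phi (step j)) ->
  rnorm (form (step j) (low n) (low n) z) <= 60 * (e * rnorm z).
Proof.
move=> e0 ke le; have [k' kk' _] := compact_adjoint ck.
have [l' ll' _] := compact_adjoint cl.
have bk : bounded_bilinear (e * rnorm z) (fun f g =>
    psi (fun x => step 0 x * f x)
      (- k (phi (fun x => step 0 x * (step j x * g x)) z))).
  apply: (@form_bounded_bilinear (step j) (fun y => - k y) (fun y => - k' y)) => //.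
    by move=> x y; rewrite hipNl hipNr kk'.
  by move=> y /=; rewrite rnormN; exact: ke.
have bl := form_bounded_bilinear z e0 (cstep j) ll' le.
apply: (paraproduct_le c_gt0 (form_id_bounded z (cstep j) (step_norm j)) bk bl).
- by rewrite mul1r rnorm_ge0.
- by rewrite mulr_ge0 ?rnorm_ge0.
- move=> f g cf cg; rewrite form_rel_k //.
  rewrite (adjoint_pair_opp (cal_adj cpsi _)) //.
  by apply/cs0/cboundedM => //; exact: cbounded_rinv.
- by move=> f g cf cg; rewrite form_rel_l.
Qed.

(** The bound on [form (step j) (low n) (low n)] is uniform in [n], so [n] may be chosen after [z],
    large enough for both truncation errors at the single vector [v]. *)
Lemma high_le j (e : R) z : 0 <= e ->
    bounded_by e (k \o phi (step j)) -> bounded_by e (l \o phi (step j)) ->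
  rnorm (psi (step 0) (phi (fun x => step 0 x * step j x) z)) <=
  60 * (e * rnorm z).
Proof.
move=> e0 ke le; set v := phi _ z.
have cadd j' := adjoint_pair_add (cal_adj cpsi (cstep j')).
have beta1 x : grid 1 <= x -> `|beta x| = x^-1.
  move=> x1; rewrite beta_inv // ger0_norm // invr_ge0.
  by rewrite (le_trans _ x1) // ltW // grid_gt0.
have gamma1 x : grid 1 <= x -> `|gamma x| = x^-1.
  move=> x1; rewrite gamma_inv // normrN ger0_norm // invr_ge0.
  by rewrite (le_trans _ x1) // ltW // grid_gt0.
apply/ler_addgt0Pr => a a0; have a20 : 0 < a / 2 by rewrite divr_gt0.
have [J1 hJ1] := step_strong cphi cbeta beta1 beta_dense v a20.
have [J2 hJ2] := step_strong cpsi cgamma gamma1 gamma_dense v a20.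
pose n := maxn J1 J2.
have {hJ1} h1 : rnorm (phi (step n) v) <= a / 2 by rewrite hJ1 // leq_maxl.
have {hJ2} h2 : rnorm (psi (step n) v) <= a / 2 by rewrite hJ2 // leq_maxr.
have clow := cbounded_low (c := c) n.
have low1 x : `|low n x| <= 1.
  rewrite ler_norml /low; have := step_ge0 (c := c) 0 x.
  have := step_le1 (c := c) 0 x; have := step_ge0 (c := c) n x.
  by have := step_le1 (c := c) n x; lra.
have vE : psi (step 0) v = form (step j) (low n) (low n) z +
    (psi (step 0) (psi (step n) v) + psi (step 0) (psi (low n) (phi (step n) v))).
  have v0 : phi (step 0) v = v.
    rewrite -(calM cphi) //; last exact: cs0.
    apply: (cal_eq cphi); [exact/cs0/cs0 | exact: cs0 |] => x x1.
    by rewrite mulrA step0_idem.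
  have -> : form (step j) (low n) (low n) z =
      psi (step 0) (psi (low n) (phi (low n) v)).
    rewrite /form (calM cpsi) //; congr (psi _ (psi _ _)).
    rewrite -(calM cphi) //; last exact: cs0.
    by congr (phi _ _); apply/funext => x; ring.
  rewrite [phi (low n) v](calB cphi) // v0 -!cadd.
  rewrite addrCA -(adjoint_pair_add (cal_adj cpsi clow)) subrK.
  rewrite [psi (low n) v](calB cpsi) // addrCA subrr addr0.
  rewrite -(calM cpsi) //; apply: (cal_eq cpsi) => // [|x x1]; first exact: cs0.
  by rewrite step0_idem.
rewrite vE (le_trans (rnormD _ _)) // lerD ?form_low_le //.
rewrite (le_trans (rnormD _ _)) //.
have g1 f y : cbounded f -> (forall x, `|f x| <= 1) -> rnorm (psi f y) <= rnorm y.
  by move=> cf f1; rewrite -[leRHS]mul1r; apply: (cal_le cpsi).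
have := g1 _ (psi (step n) v) (cstep 0) (step_norm 0).
have := g1 _ (psi (low n) (phi (step n) v)) (cstep 0) (step_norm 0).
have := g1 _ (phi (step n) v) clow low1.
lra.
Qed.

(** Write [g = (c^-1 + rinv) G]. The relation trades [rinv G] on the right for [- rinv f] on the
    left, modulo a compact term, so that [(f, g)] becomes [((c^-1 - rinv) f, G)]. The first factor
    is at most [c^-1], and the division gains [c^-1 + (grid J)^-1] because [g] vanishes beyond
    [grid J]: the quotient is less than 1. *)
Lemma low_compact_iter n J f g (s t : R) : cbounded f -> cbounded g ->
    0 <= s -> 0 <= t -> (forall x, `|f x| <= s) ->
    (forall x, `|g x| <= if x <= grid J then t else 0) ->
  exists2 L, compact_operator L &
    bounded_by ((c^-1 / (c^-1 + (grid J)^-1)) ^+ n * (s * t))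
      (fun z => form (fun=> 1) f g z - L z).
Proof.
have c1 : 0 < c^-1 by rewrite invr_gt0.
have gJ := grid_gt0 c_gt0 J; have gJ1 : 0 < (grid J)^-1 by rewrite invr_gt0.
have ct := cbounded_cst (1 : R).
elim: n f g s t => [|n ih] f g s t cf cg s0 t0 fs gt.
  exists (fun=> 0); first exact: compact0.
  move=> z; rewrite subr0 expr0 mul1r.
  have := @bil_le _ _ _ _ (@form_id_bounded (fun=> 1) z ct _) f g s t.
  rewrite mul1r; apply => // x; first by rewrite normr1.
  by rewrite (le_trans (gt x)) //; case: ifP.
pose G x := g x / (c^-1 + rinv x).
have r0 x : 0 < rinv x := rinv_gt0 c_gt0 x.
have rc x : rinv x <= c^-1 := rinv_le c_gt0 x.
have cr := cbounded_rinv c_gt0.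
have R0 x : 0 < c^-1 + rinv x by have := r0 x; lra.
have cG : cbounded G.
  apply: cboundedM => //; split.
    move=> x; apply: cvgV; first by rewrite gt_eqF.
    by apply: cvgD; [exact: cvg_cst | case: cr => + _; exact].
  exists c => x; rewrite ger0_norm ?invr_ge0 ?(ltW (R0 x)) //.
  by rewrite -[leRHS]invrK lef_pV2 ?posrE // lerDl (ltW (r0 x)).
pose f' x := (c^-1 - rinv x) * f x.
have cf' : cbounded f' by apply/cboundedM => //; apply/cboundedB => //; exact: cbounded_cst.
have [||||L cL hL] := ih f' G (c^-1 * s) (t / (c^-1 + (grid J)^-1)) cf' cG.
- by rewrite mulr_ge0 ?(ltW c1).
- by apply: divr_ge0 => //; apply: addr_ge0; exact: ltW.
- move=> x; rewrite normrM ler_pM // ger0_norm; last by rewrite subr_ge0.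
  by have := r0 x; lra.
- move=> x; have := gt x; case: ifP => [xJ gx|_]; last first.
    by rewrite normr_le0 /G => /eqP ->; rewrite mul0r normr0.
  rewrite normrM ler_pM // ger0_norm ?invr_ge0 ?(ltW (R0 x)) //.
  rewrite lef_pV2 ?posrE // ?addr_gt0 // lerD2l lef_pV2 ?posrE //.
    by rewrite ge_max xJ grid_ge.
  by rewrite lt_max c_gt0.
have crf : cbounded (fun x => rinv x * f x) by exact: cboundedM.
have crG : cbounded (fun x => rinv x * G x) by exact: cboundedM.
pose K z := psi (fun x => step 0 x * (rinv x * f x))
  (k (phi (fun x => step 0 x * (1 * G x)) z)).
have cK : compact_operator K.
  apply: (@compact_compl _ _ _ (psi (fun x => step 0 x * (rinv x * f x)))
    _ (k \o phi (fun x => step 0 x * (1 * G x)))).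
    exact/(cal_adj cpsi)/cs0.
  apply: (@compact_compr _ _ _ k) ck.
  by apply/(cal_adj cphi)/cs0/cboundedM.
exists (fun z => L z - K z); first exact: compactB.
move=> z; have n1 (x : R) : `|1 : R| <= 1 by rewrite normr1.
have bz := form_id_bounded z ct n1.
have fgE : form (fun=> 1) f g z = form (fun=> 1) f' G z - K z.
  have gE : g = fun x => c^-1 * G x + rinv x * G x.
    by apply/funext => x; rewrite -mulrDl mulrC divfK // gt_eqF.
  have f'E : f' = fun x => c^-1 * f x - rinv x * f x.
    by apply/funext => x; rewrite /f' mulrBl.
  have e1 := bilDr bz cf (cboundedZ c^-1 cG) crG.
  have e2 := bilZr bz c^-1 cf cG.
  have e3 := bilBl bz (cboundedZ c^-1 cf) crf cG.
  have e4 := bilZl bz c^-1 cf cG.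
  have e5 := form_rel_k z ct cf cG.
  rewrite /= -gE -f'E in e1 e2 e3 e4 e5.
  rewrite e1 e2 e3 e4 (esym e5 : - K z = _).
  by rewrite [X in _ = _ + X]addrC addrA subrK.
rewrite fgE opprB addrA subrK (le_trans (hL z)) // ler_wpM2r ?rnorm_ge0 //.
rewrite le_eqVlt; apply/orP; left; apply/eqP; rewrite exprSr; set p := _ ^+ n; set q := (_ + _)^-1; ring.
Qed.

Lemma form_low_compact J f g (t : R) : cbounded f -> cbounded g -> 0 <= t ->
    (forall x, `|f x| <= t) -> (forall x, `|g x| <= if x <= grid J then t else 0) ->
  compact_operator (form (fun=> 1) f g).
Proof.
move=> cf cg t0 ft gt; apply: compact_closed => e e0.
have c1 : 0 < c^-1 by rewrite invr_gt0.
have gJ : 0 < (grid J)^-1 by rewrite invr_gt0 grid_gt0.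
have q0 : 0 <= c^-1 / (c^-1 + (grid J)^-1) by rewrite divr_ge0 ?addr_ge0 // ltW.
have q1 : c^-1 / (c^-1 + (grid J)^-1) < 1.
  by rewrite ltr_pdivrMr ?addr_gt0 // mul1r ltrDl.
have a0 : 0 < e / (1 + t * t) by rewrite divr_gt0 // ltr_wpDr // mulr_ge0.
have [n hn] := exprn_le_eps q0 q1 a0.
have [L cL hL] := low_compact_iter n cf cg t0 t0 ft gt.
exists L => // z; rewrite (le_trans (hL z)) // ler_wpM2r ?rnorm_ge0 //.
move: hn; rewrite ler_pdivlMr ?ltr_wpDr ?mulr_ge0 //.
have := exprn_ge0 n q0; lra.
Qed.

Theorem compact_step_product :
  compact_operator (fun z => psi (step 0) (phi (step 0) z)).
Proof.
have beta1 x : grid 1 <= x -> `|beta x| = x^-1.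
  move=> x1; rewrite beta_inv // ger0_norm // invr_ge0.
  by rewrite (le_trans _ x1) // ltW // grid_gt0.
apply: compact_closed => e e0; have e60 : 0 < e / 60 by rewrite divr_gt0.
have [J1 hJ1] := compact_step_small cphi cbeta beta1 beta_dense ck e60.
have [J2 hJ2] := compact_step_small cphi cbeta beta1 beta_dense cl e60.
pose j := maxn J1 J2.
have c1 := cbounded_cst (1 : R).
have cs : cbounded (fun x => 1 - step j x) by exact: cboundedB.
(* In the variable of [T], [1 - step j] vanishes beyond [grid j.+1] and gives a compact operator;
   the remaining part, with [step j], has norm at most [60 * (e / 60)]. *)
exists (form (fun=> 1) (fun=> 1) (fun x => 1 - step j x)).
  apply: (@form_low_compact j.+1 _ _ 1) => // x; first by rewrite normr1.
  case: ifP => [_|/negbT]; last first.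
    by rewrite -ltNge => xj; rewrite step1 ?subrr ?normr0 // ltW.
  rewrite ger0_norm ?subr_ge0 ?step_le1 //.
  by have := step_ge0 (c := c) j x; lra.
move=> z; have -> : psi (step 0) (phi (step 0) z) -
    form (fun=> 1) (fun=> 1) (fun x => 1 - step j x) z =
    psi (step 0) (phi (fun x => step 0 x * step j x) z).
  rewrite /form; have -> : (fun x => step 0 x * 1) = step 0.
    by apply/funext => x; rewrite mulr1.
  rewrite -(adjoint_pair_sub (cal_adj cpsi (cstep 0))); congr (psi _ _).
  have -> : (fun x => step 0 x * (1 * (1 - step j x))) =
      fun x => step 0 x - step 0 x * step j x.
    by apply/funext => x; rewrite mul1r mulrBr mulr1.
  have csj := cs0 (cstep j).
  by rewrite (calB cphi z (cstep 0) csj) opprB addrC subrK.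
rewrite (le_trans (@high_le j _ z (ltW e60) _ _)) //.
- exact/hJ1/leq_maxl.
- exact/hJ2/leq_maxr.
- lra.
Qed.

End Core.
End RealCalculus.

(** * From the functional calculus to real functions *)

Section ComplexFunctions.
Context {R : realType}.
Implicit Types (a b f : R -> R) (x : R) (D : set R).

Lemma normc_le_ReIm (z : R[i]) :
  complex.Re `|z| <= `|complex.Re z| + `|complex.Im z|.
Proof.
case: z => a b; rewrite normc_def /= -[leRHS]ger0_norm ?addr_ge0 //.
rewrite -sqrtr_sqr ler_wsqrtr // sqrrD !real_normK ?num_real //.
by rewrite addrAC lerDl mulrn_wge0 // mulr_ge0.
Qed.

Lemma within_continuous_complex D a b : continuous a -> continuous b ->
  {within D, continuous ((fun x => a x +i* b x) : R -> R[i]^o)}.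
Proof.
move=> ca cb.
apply: continuous_subspaceT => x; apply/(@cvgrPdist_le _ R[i]^o) => e e0.
have eR : e = (complex.Re e)%:C by rewrite RRe_real // gtr0_real.
have e20 : 0 < complex.Re e / 2 by rewrite divr_gt0 // -ltcR -eR.
move/cvgrPdist_le: (ca x) => /(_ _ e20) ha.
move/cvgrPdist_le: (cb x) => /(_ _ e20) hb.
near=> y.
rewrite eR -[`|_|]RRe_real ?normr_real // lecR.
rewrite (le_trans (normc_le_ReIm _)) //= [leRHS]splitr lerD //.
  by near: y.
by near: y.
Unshelve. all: by end_near. Qed.

Lemma bounded_continuous_complex D a b : cbounded a -> cbounded b ->
  bounded_continuous_on D (fun x => a x +i* b x).
Proof.
move=> [ca [M hM]] [cb [N hN]]; split; first exact: within_continuous_complex.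
exists (M + N)%:C => x _.
rewrite -[`|_|]RRe_real ?normr_real // lecR.
by rewrite (le_trans (normc_le_ReIm _)) //= lerD.
Qed.

Lemma cbounded_complex D f : cbounded f ->
  bounded_continuous_on D (fun x => (f x)%:C).
Proof. by move=> cf; apply: bounded_continuous_complex; last exact: cbounded_cst. Qed.

(** The function [1 / x] continued linearly across the gap; it is odd, as the reflection of the line
    requires. *)
Definition cut_inv (d x : R) : R := x * (Num.max d `|x|) ^- 2.

Lemma cut_invE d x : 0 < d -> d <= `|x| -> cut_inv d x = x^-1.
Proof.
move=> d0 dx; rewrite /cut_inv max_r // real_normK ?num_real //.
have x0 : x != 0 by rewrite -normr_gt0 (lt_le_trans d0).
by field.
Qed.

Lemma cut_invN d x : cut_inv d (- x) = - cut_inv d x.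
Proof. by rewrite /cut_inv normrN mulNr. Qed.

Lemma cbounded_cut_inv d : 0 < d -> cbounded (cut_inv d).
Proof.
move=> d0; split; last first.
  exists d^-1 => x; rewrite normrM normfV normrX.
  have m0 : 0 < Num.max d `|x| by rewrite lt_max d0.
  rewrite (ger0_norm (ltW m0)) ler_pdivrMr ?exprn_gt0 // expr2 mulrA.
  rewrite (@le_trans _ _ (1 * Num.max d `|x|)) //.
    by rewrite mul1r le_max lexx orbT.
  by rewrite ler_wpM2r ?(ltW m0) // mulrC ler_pdivlMr // mul1r le_max lexx.
move=> x; apply: cvgM; first exact: cvg_id.
apply: cvgV; first by rewrite expf_neq0 // gt_eqF // lt_max d0.
have cm : continuous (fun y : R => Num.max d `|y|).
  apply: max_fun_continuous; first exact: cst_continuous.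
  exact: norm_continuous.
by apply: cvgM; exact: cm.
Qed.

End ComplexFunctions.

Section FunctionalCalculus.
Context {R : realType} {A : cstarAlgType R} {E : hilbertModType A}.
Context {T : operator E} {Phi : (R -> R[i]) -> E -> E} {c : R}.
Hypothesis c_gt0 : 0 < c.
Hypothesis Phi_calculus : functional_calculus T Phi.
Hypothesis gap : forall x, `|x| < grid (c := c) 1 -> ~ spectrum T x.
Implicit Types (f g : R -> R) (x : R) (z : E).

Let real_phi f := Phi (fun x => (f x)%:C).

Let spectrum_ge x : spectrum T x -> grid (c := c) 1 <= `|x|.
Proof. by move=> Tx; rewrite leNgt; apply/negP => /gap. Qed.

Lemma calculus_unitary_isometric (a b : R -> R) z : cbounded a -> cbounded b ->
    (forall x, a x ^+ 2 + b x ^+ 2 = 1) ->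
  rnorm (Phi (fun x => a x +i* b x) z) = rnorm z.
Proof.
move=> ca cb ab; have [_ _ [mulP oneP] adjP _] := Phi_calculus.
have cu := bounded_continuous_complex (spectrum T) ca cb.
have cv := bounded_continuous_complex (spectrum T) ca (cboundedN cb).
apply/eqP; rewrite -(@eqrXn2 _ 2) ?rnorm_ge0 // -!rnorm_hipxx adjP //.
rewrite -[Phi (fun x => _) (Phi _ z)]/((Phi _ \o Phi _) z) -mulP //.
have -> : (fun x => (a x +i* b x)^*%C * (a x +i* b x)) = fun=> 1.
  apply/funext => x; simpc; congr (_ +i* _); last by ring.
  by rewrite -(ab x); ring.
by rewrite oneP.
Qed.

Lemma real_calculusP : real_calculus (c := c) real_phi.
Proof.
have [eqPhi linP [mulP oneP] adjP _] := Phi_calculus.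
have cC f : cbounded f -> bounded_continuous_on (spectrum T) (fun x => (f x)%:C).
  exact: cbounded_complex.
have eq_phi f g : cbounded f -> cbounded g ->
    (forall x, grid (c := c) 1 <= `|x| -> f x = g x) -> real_phi f =1 real_phi g.
  move=> cf cg fg; apply: eqPhi; [exact: cC | exact: cC |] => x /spectrum_ge x1.
  by rewrite fg.
have D f g z : cbounded f -> cbounded g ->
    real_phi (fun x => f x + g x) z = real_phi f z + real_phi g z.
  move=> cf cg; rewrite -[real_phi f z]scale1r -linP; try exact: cC.
  by congr (Phi _ _); apply/funext => x; rewrite mul1r rmorphD.
have Z (a : R) f z : cbounded f -> real_phi (fun x => a * f x) z = a%:C *: real_phi f z.
  (* The linearity axiom always adds a second term; [f] itself serves as that term. *)
  move=> cf; have -> : a%:C *: real_phi f z = (a - 1)%:C *: real_phi f z + real_phi f z.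
    by rewrite rmorphB scalerBl scale1r subrK.
  rewrite -linP; try exact: cC.
  congr (Phi _ _); apply/funext => x.
  by rewrite -rmorphM -rmorphD; congr (_%:C); rewrite mulrBl mul1r subrK.
split=> //.
- move=> f g z cf cg; rewrite -[RHS]/((Phi _ \o Phi _) z) -mulP; try exact: cC.
  by congr (Phi _ _); apply/funext => x; rewrite rmorphM.
- move=> f cf x y; rewrite adjP; last exact: cC.
  by congr (hip _ (Phi _ _)); apply/funext => w; rewrite conjc_real.
move=> f a cf fa z.
have d0 : 0 < grid (c := c) 1 by exact: grid_gt0.
have a0 : 0 <= a.
  rewrite (le_trans (normr_ge0 (f (grid (c := c) 1)))) // fa //.
  by rewrite ger0_norm // ltW.
(* The margin keeps the divisor [r] positive even when [a] is 0. *)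
apply/ler_addgt0Pr => e e0; pose r := a + e / (1 + rnorm z).
have z1 : 0 < 1 + rnorm z by rewrite ltr_wpDr ?rnorm_ge0.
have r0 : 0 < r by rewrite ltr_wpDl // divr_gt0.
(* The bound on [f] holds only outside the gap; clipping makes [1 - u ^+ 2] nonnegative everywhere
   without changing [real_phi]. *)
pose u x : R := Num.min 1 (Num.max (- 1) (r^-1 * f x)).
have cu : cbounded u.
  by apply: cbounded_clip => x; apply: cvgM; [exact: cvg_cst | case: cf => + _; exact].
have u1 x : `|u x| <= 1.
  rewrite ler_norml /u le_min ge_min lexx /= andbT le_max lexx andbT; lra.
pose v x := Num.sqrt (1 - u x ^+ 2).
have u2 x : 0 <= 1 - u x ^+ 2.
  by rewrite subr_ge0 -[u x ^+ 2]real_normK ?num_real // expr_le1.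
have cv : cbounded v.
  split.
    move=> x; apply: (continuous_comp (f := fun x => 1 - u x ^+ 2)); last exact: sqrt_continuous.
    apply: cvgB; first exact: cvg_cst.
    by apply: cvgM; case: cu => + _; exact.
  exists 1 => x; rewrite ger0_norm ?sqrtr_ge0 // -sqrtr1 ler_wsqrtr //.
  by rewrite lerBlDr lerDl sqr_ge0.
have uv x : u x ^+ 2 + v x ^+ 2 = 1 by rewrite sqr_sqrtr // addrC subrK.
have fE : real_phi f z = r%:C *: real_phi u z.
  rewrite -Z //; apply: eq_phi => //; first exact: cboundedZ.
  move=> x /fa fx; rewrite /u.
  have : `|r^-1 * f x| <= 1.
    rewrite normrM gtr0_norm ?invr_gt0 // ler_pdivrMl // mulr1 (le_trans fx) //.
    by rewrite lerDl divr_ge0 // ltW.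
  rewrite ler_norml => /andP[h1 h2].
  by rewrite max_r // min_r // mulrA divff ?mul1r // gt_eqF.
have uE : (2%:R : R)%:C *: real_phi u z =
    Phi (fun x => u x +i* v x) z + Phi (fun x => u x -i* v x) z.
  rewrite -Z // -[Phi _ z in RHS]scale1r -linP; last 2 first.
  - exact: bounded_continuous_complex.
  - by apply: bounded_continuous_complex => //; exact: cboundedN.
  congr (Phi _ _); apply/funext => x; rewrite mul1r; simpc.
  by congr (_ +i* _); ring.
have uz : rnorm (real_phi u z) <= rnorm z.
  have := rnormD (Phi (fun x => u x +i* v x) z) (Phi (fun x => u x -i* v x) z).
  rewrite -uE rnormZr normr_nat calculus_unitary_isometric //.
  rewrite (@calculus_unitary_isometric u (fun x => - v x)) //; first lra.
    exact: cboundedN.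
  by move=> x; rewrite sqrrN.
rewrite fE rnormZr gtr0_norm // (le_trans (ler_wpM2l (ltW r0) uz)) //.
rewrite mulrDl lerD2l mulrAC ler_pdivrMr // ler_wpM2l ?(ltW e0) //.
by rewrite lerDr.
Qed.

End FunctionalCalculus.

(** * Unbounded operators *)

Section Inverse.
Context {R : realType} {A : cstarAlgType R} {E : hilbertModType A}.
Implicit Types (T : operator E) (x y z : E).

Lemma op_invP T y : op_range T y -> dom T (op_inv T y) /\ T (op_inv T y) = y.
Proof. by move=> [x Tx xy]; apply: (@xgetPex _ 0 [set x | dom T x /\ T x = y]); exists x. Qed.

Lemma op_inv_full T y : op_range T = setT ->
  dom T (op_inv T y) /\ T (op_inv T y) = y.
Proof. by move=> rT; apply: op_invP; rewrite rT. Qed.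

Lemma op_invK T x : {in dom T &, injective T} -> dom T x -> op_inv T (T x) = x.
Proof.
move=> injT Tx; have rTx : op_range T (T x) by exists x.
have [Ti TiE] := op_invP rTx.
by apply: injT; rewrite ?inE.
Qed.

Lemma op_inv_adjoint T : symmetric_operator T -> op_range T = setT ->
  adjoint_pair (op_inv T) (op_inv T).
Proof.
move=> symT rT x y.
have [Tx xE] := op_inv_full x rT; have [Ty yE] := op_inv_full y rT.
by rewrite -{1}yE -symT // xE.
Qed.

Lemma self_adjoint_symmetric T : self_adjoint T -> symmetric_operator T.
Proof.
move=> [domT adjT] x y Tx Ty; rewrite adjT //.
have : dom (op_adj T) x by rewrite -domT.
by move=> /(@xgetPex _ 0 (adj_spec T x)); exact.
Qed.

Lemma op_shift_symmetric T (r : R) : symmetric_operator T ->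
  symmetric_operator (op_shift T (- r%:C)).
Proof.
move=> symT x y Tx Ty /=.
by rewrite hipDl hipDr hipZl hipZr symT // -rmorphN conjc_real.
Qed.

(** If [T w = - 'i *: w], symmetry gives ['i *: hip w w = - 'i *: hip w w]. Injectivity identifies
    the chosen preimages of [op_inv] in computations with [(T + i)^-1]. *)
Lemma op_shift_i_injective T : linear_operator T -> symmetric_operator T ->
  {in dom T &, injective (op_shift T 'i)}.
Proof.
move=> [_ Dlin Zlin _] symT x y; rewrite !inE => Tx Ty /= xy.
have [Ny NyE] := Zlin (-1) y Ty.
have [Td TdE] := Dlin _ _ Tx Ny.
pose w := x - y; have wE : w = x + (-1) *: y by rewrite scaleN1r.
have Tw : dom T w by rewrite wE.
have TwE : T w = - 'i *: w.
  rewrite wE TdE NyE !scaleN1r; apply/eqP; rewrite -subr_eq0 scaleNr opprK.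
  by rewrite scalerBr addrACA -opprD xy subrr.
have := symT w w Tw Tw; rewrite TwE hipZl hipZr => /eqP.
rewrite -subr_eq0 -scalerBl scaler_eq0 => /orP[/eqP|/eqP ww].
  by move=> /(congr1 (@complex.Im R))/eqP; rewrite /= !opprK (@pnatr_eq0 _ 2).
have : w = 0.
  by apply/rnorm0_eq0/eqP; rewrite -sqrf_eq0 -rnorm_hipxx ww rnorm0.
by move/eqP; rewrite subr_eq0 => /eqP.
Qed.

(* Neumann series, summed by the contraction [u |-> y + r b u]. *)
Lemma neumann_surjective b (C r : R) y : adjoint_pair b b ->
    bounded_by C b -> `|r| * C <= 2^-1 ->
  exists z, z - r%:C *: b z = y.
Proof.
move=> bb Cb rC.
have half x : rnorm (r%:C *: b x) <= 2^-1 * rnorm x.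
  rewrite rnormZr (le_trans (ler_wpM2l (normr_ge0 r) (Cb x))) // mulrA.
  by rewrite ler_wpM2r ?rnorm_ge0.
pose u := fix u n := if n is m.+1 then y + r%:C *: b (u m) else 0.
pose p n : R := 2^-1 ^+ n.
have p0 n : 0 < p n by rewrite exprn_gt0 // invr_gt0.
have pS n : p n.+1 = 2^-1 * p n by rewrite /p exprS.
have step_le n : rnorm (u n.+1 - u n) <= rnorm y * p n.
  elim: n => [|n ih].
    by rewrite /= (adjoint_pair0 bb) scaler0 addr0 subr0 /p expr0 mulr1.
  rewrite [u n.+2]/= [u n.+1 in X in _ - X]/= opprD addrACA subrr add0r -scalerBr.
  rewrite -(adjoint_pair_sub bb) (le_trans (half _)) // pS; lra.
have cauchy n m : (n <= m)%N -> rnorm (u m - u n) <= 2 * rnorm y * p n.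
  move=> /subnK <-; move: (m - n)%N => j; elim: j n => [|j ih] n.
    by rewrite add0n subrr rnorm0 !mulr_ge0 ?rnorm_ge0 ?(ltW (p0 n)).
  have := rnormD (u (j + n.+1)%N - u n.+1) (u n.+1 - u n).
  rewrite addrA subrK addSnnS; have := ih n.+1; have := step_le n.
  rewrite pS; lra.
have pe (a : R) : 0 < a -> exists n, p n <= a.
  by apply: exprn_le_eps; rewrite ?invr_ge0 // invf_lt1 ?ltr1n.
have y1 : 0 < 1 + 2 * rnorm y by rewrite ltr_wpDr // mulr_ge0 ?rnorm_ge0.
have [a a0|l ul] := rnorm_complete cauchy.
  have [|n hn] := pe (a / (1 + 2 * rnorm y)); first by rewrite divr_gt0.
  exists n; move: hn; rewrite ler_pdivlMr //; have := p0 n; lra.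
exists l; apply: rnorm_le_eps => e e0.
have [|n hn] := pe (e / (1 + 2 * rnorm y)); first by rewrite divr_gt0.
have -> : l - r%:C *: b l - y = (l - u n.+1) - r%:C *: b (l - u n).
  rewrite /= (adjoint_pair_sub bb) scalerBr; set p1 := _ *: b l; set p2 := _ *: _.
  by rewrite opprB opprD [l + (_ - _)]addrA [RHS]addrA subrK addrAC.
move: hn; rewrite ler_pdivlMr // => hn.
have := rnormB (l - u n.+1) (r%:C *: b (l - u n)).
have := ul n; have := ul n.+1; have := half (l - u n); rewrite pS.
have := p0 n; lra.
Qed.

(** For [b = T^-1] one has [(T - r) b = 1 - r b], invertible for small [r]. Adjointability of the
    inverse then comes from symmetry and surjectivity. *)
Lemma spectrum_gap T : linear_operator T -> symmetric_operator T ->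
    invertible T ->
  exists2 d : R, 0 < d & forall x : R, `|x| < d -> ~ spectrum T x.
Proof.
move=> [_ Dlin Zlin _] symT [injT rT _].
pose b := op_inv T; have bb : adjoint_pair b b by exact: op_inv_adjoint.
have bP y : dom T (b y) /\ T (b y) = y by exact: op_inv_full.
have [C C0 Cb] := adjoint_pair_bounded bb.
exists (2 * (1 + C))^-1; first by rewrite invr_gt0 mulr_gt0 // ltr_wpDr.
move=> r rd; have rC : `|r| * C <= 2^-1.
  move: (ltW rd); rewrite invfM ler_pdivlMr ?ltr_wpDr //.
  by have := normr_ge0 r; lra.
apply; split.
- move=> x y; rewrite !inE => Tx Ty /= xy.
  have [Ny NyE] := Zlin (-1) y Ty; have [Td TdE] := Dlin _ _ Tx Ny.
  pose w := x - y; have wE : w = x + (-1) *: y by rewrite scaleN1r.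
  have Tw : dom T w by rewrite wE.
  have TwE : T w = r%:C *: w.
    rewrite wE TdE NyE !scaleN1r scalerBr; move/eqP: xy.
    rewrite !scaleNr subr_eq => /eqP ->.
    by rewrite addrAC [T y - _]addrC addrK addrC.
  have bw : w = r%:C *: b w.
    by rewrite -(adjoint_pair_scale bb) -TwE [b _]op_invK.
  have w0 : w = 0.
    apply: rnorm0_eq0; have := rnorm_ge0 w.
    have : rnorm w <= `|r| * (C * rnorm w) by rewrite {1}bw rnormZr ler_wpM2l.
    rewrite mulrA; have := ler_wpM2r (rnorm_ge0 w) rC; lra.
  by apply/eqP; rewrite -subr_eq0 -/w w0.
- apply/seteqP; split=> // y _.
  have [z zE] := neumann_surjective y bb Cb rC.
  have [Tb TbE] := bP z.
  by exists (b z) => //=; rewrite TbE scaleNr.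
- have sym := @op_shift_symmetric T r symT.
  exists (op_inv (op_shift T (- r%:C))); apply: op_inv_adjoint => //.
  apply/seteqP; split=> // y _.
  have [z zE] := neumann_surjective y bb Cb rC.
  have [Tb TbE] := bP z.
  by exists (b z) => //=; rewrite TbE scaleNr.
Qed.

End Inverse.

Section CalculusInverse.
Context {R : realType} {A : cstarAlgType R} {E : hilbertModType A}.
Context {T : operator E} {Phi : (R -> R[i]) -> E -> E} {d : R}.
Hypotheses (T_linear : linear_operator T) (T_symmetric : symmetric_operator T).
Hypothesis T_invertible : invertible T.
Hypothesis Phi_calculus : functional_calculus T Phi.
Hypothesis d_gt0 : 0 < d.
Hypothesis gap : forall x : R, `|x| < d -> ~ spectrum T x.

(* With [r = (T + i)^-1], both [T^-1] and the calculus of [1/x] are the inverse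
   of [1 - i r] times [r]. *)
Lemma calculus_cut_inv z : Phi (fun x => (cut_inv d x)%:C) z = op_inv T z.
Proof.
have [eqPhi linP [mulP oneP] _ [resP _]] := Phi_calculus.
have [injT rT _] := T_invertible.
set b := op_inv T; pose B := Phi (fun x => (cut_inv d x)%:C).
pose f x : R[i] := (x%:C + 'i%C)^-1; pose r := Phi f.
have D0 x : 1 + x ^+ 2 != 0 :> R by rewrite gt_eqF // ltr_wpDr ?sqr_ge0.
have fE : f = fun x => (x / (1 + x ^+ 2)) +i* (- (1 + x ^+ 2)^-1).
  apply/funext => x; rewrite /f; apply/(mulfI (x := x%:C + 'i%C)).
    by rewrite eq_complex /= add0r oner_eq0 andbF.
  rewrite divff; last by rewrite eq_complex /= add0r oner_eq0 andbF.
  have := D0 x => Dx; simpc; congr (_ +i* _); field => //.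
have cden : cbounded (fun x : R => (1 + x ^+ 2)^-1).
  split.
    move=> x; apply: cvgV => //; apply: cvgD; first exact: cvg_cst.
    by apply: cvgM; exact: cvg_id.
  exists 1 => x; rewrite ger0_norm ?invr_ge0 ?addr_ge0 ?sqr_ge0 //.
  by rewrite invf_le1 ?ltr_wpDr ?sqr_ge0 // lerDl sqr_ge0.
have cnum : cbounded (fun x : R => x / (1 + x ^+ 2)).
  split; first by move=> x; apply: cvgM; [exact: cvg_id | case: cden => + _; exact].
  exists 1 => x; have x2 : 0 < 1 + x ^+ 2 by rewrite ltr_wpDr ?sqr_ge0.
  rewrite normrM normfV (gtr0_norm x2) ler_pdivrMr // mul1r.
  rewrite -[x ^+ 2]real_normK ?num_real //; have := sqr_ge0 (`|x| - 1); nra.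
have cNden := cboundedN cden.
have cf : bounded_continuous_on (spectrum T) f.
  by rewrite fE; exact: bounded_continuous_complex.
have cB : bounded_continuous_on (spectrum T) (fun x => (cut_inv d x)%:C).
  by apply: cbounded_complex; exact: cbounded_cut_inv.
have c1 : bounded_continuous_on (spectrum T) (fun=> 1).
  exact: (@cbounded_complex R (spectrum T) (fun=> 1) (cbounded_cst 1)).
pose g x : R[i] := - 'i%C * f x + 1.
have cg : bounded_continuous_on (spectrum T) g.
  have -> : g = fun x => (- (1 + x ^+ 2)^-1 + 1) +i* (- (x / (1 + x ^+ 2))).
    by apply/funext => x; rewrite /g fE; simpc; congr (_ +i* _); ring.
  apply: bounded_continuous_complex; last exact: cboundedN.
  by apply: cboundedD => //; exact: cbounded_cst.
have Br y : B (y - 'i *: r y) = r y.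
  have -> : y - 'i *: r y = Phi g y.
    by rewrite linP // oneP scaleNr addrC.
  rewrite -[LHS]/((Phi _ \o Phi _) y) -mulP //; apply: eqPhi => //.
    have -> : (fun x => (cut_inv d x)%:C * g x) = fun x =>
        (cut_inv d x * (- (1 + x ^+ 2)^-1 + 1)) +i*
        (cut_inv d x * (- (x / (1 + x ^+ 2)))).
      by apply/funext => x; rewrite /g fE; simpc; congr (_ +i* _); ring.
    have ci := cbounded_cut_inv d_gt0.
    apply: bounded_continuous_complex; apply: cboundedM => //.
      by apply: cboundedD => //; exact: cbounded_cst.
    exact: cboundedN.
  move=> x Tx; have dx : d <= `|x| by rewrite leNgt; apply/negP => /gap.
  rewrite cut_invE // /g /f fmorphV.
  have x0 : x%:C != 0 :> R[i].
    by rewrite fmorph_eq0 -normr_gt0 (lt_le_trans d_gt0).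
  have xi0 : x%:C + 'i%C != 0 :> R[i].
    by rewrite eq_complex /= add0r oner_eq0 andbF.
  by field; rewrite x0 xi0.
have rb y : r (y + 'i *: b y) = b y.
  have [Tb TbE] := op_inv_full y rT.
  rewrite /r resP -{1}TbE -[LHS]/(op_inv _ (op_shift T 'i (op_inv T y))).
  exact: (@op_invK _ _ _ (op_shift T 'i) _
    (op_shift_i_injective T_linear T_symmetric)).
(* At [y = z + 'i *: b z] one has [r y = b z], so [y - 'i *: r y] is just [z]. *)
by have := Br (z + 'i *: b z); rewrite rb addrK.
Qed.

End CalculusInverse.

(** * From the products of projections to their difference *)

Section ProjectionDifference.
Context {R : realType} {A : cstarAlgType R} {E : hilbertModType A}.
Context {c : R} (c_gt0 : 0 < c).
Context {phi psi : (R -> R) -> E -> E} {k l : E -> E}.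
Hypotheses (cphi : real_calculus (c := c) phi).
Hypotheses (cpsi : real_calculus (c := c) psi).
Local Notation d := (grid (c := c) 1).
Hypothesis phi_dense : dense (range (phi (cut_inv d))).
Hypothesis psi_dense : dense (range (psi (cut_inv d))).
Hypotheses (ck : compact_operator k) (cl : compact_operator l).
Hypothesis resolvent_k : forall z,
  phi (cut_inv d) z = psi (cut_inv d) (z + k z).
Hypothesis resolvent_l : forall z,
  psi (cut_inv d) z = phi (cut_inv d) z - l (phi (cut_inv d) z).

Let flip (phi0 : (R -> R) -> E -> E) f := phi0 (fun x => f (- x)).

Lemma real_calculus_flip phi0 : real_calculus (c := c) phi0 ->
  real_calculus (c := c) (flip phi0).
Proof.
move=> [eq D Z M one adj le]; have co := cbounded_comp_opp; split.
- by move=> f g cf cg fg; apply: eq; [exact: co|exact: co|] => x x1; apply: fg;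
    rewrite normrN.
- by move=> f g z cf cg; rewrite -D //; exact: co.
- by move=> a f z cf; rewrite -Z //; exact: co.
- by move=> f g z cf cg; rewrite /flip -M //; exact: co.
- exact: one.
- by move=> f cf; apply: adj; exact: co.
- by move=> f a cf fa; apply: le; [exact: co|] => x x1; apply: fa; rewrite normrN.
Qed.

Lemma compact_projection_difference :
  compact_operator (fun z => psi (step (c := c) 0) z - phi (step (c := c) 0) z).
Proof.
have d0 : 0 < d by exact: grid_gt0.
have cs := cbounded_step (c := c) 0; have ci := cbounded_cut_inv d0.
have cNi := cboundedN ci; have c1 := cbounded_cst (1 : R).
have iE x : d <= x -> cut_inv d x = x^-1.
  by move=> dx; rewrite cut_invE // ger0_norm // (le_trans (ltW d0)).
have iN : (fun x => cut_inv d (- x)) = (fun x => - cut_inv d x).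
  by apply/funext => x; rewrite cut_invN.
have NiN : (fun x => - cut_inv d (- x)) = cut_inv d.
  by apply/funext => x; rewrite cut_invN opprK.
have opp phi0 f z : real_calculus (c := c) phi0 -> cbounded f ->
    phi0 (fun x => - f x) z = - phi0 f z.
  move=> c0 cf; under [in LHS]eq_fun do rewrite -mulN1r.
  by rewrite (calZ c0) // rmorphN1 scaleN1r.
(* Outside the gap [step 0 (- x) = 1 - step 0 x]: reflection exchanges the positive and negative
   projections. *)
have flip_step phi0 z : real_calculus (c := c) phi0 ->
    flip phi0 (step (c := c) 0) z = z - phi0 (step (c := c) 0) z.
  move=> c0; rewrite -{2}(cal1 c0 z) -(calB c0) //.
  apply: (cal_eq c0); [exact: cbounded_comp_opp | exact: cboundedB |].
  move=> x dx; have [x0|x0] := leP 0 x.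
    rewrite ger0_norm // in dx; rewrite [step _ x]step1 // subrr step0 //.
    by rewrite (le_trans _ (ltW (grid_gt0 c_gt0 0))) // oppr_le0.
  rewrite ltr0_norm // in dx; rewrite step1 // step0 ?subr0 //.
  by rewrite (le_trans (ltW x0)) // ltW // grid_gt0.
have oppdense phi0 f : real_calculus (c := c) phi0 -> cbounded f ->
    dense (range (phi0 f)) -> dense (range (phi0 (fun x => - f x))).
  move=> c0 cf; congr dense; apply/seteqP; split=> _ [z _ <-]; exists (- z) => //.
    by rewrite opp // (adjoint_pair_opp (cal_adj c0 cf)) ?opprK.
  by rewrite opp // (adjoint_pair_opp (cal_adj c0 cf)) ?opprK.
have [l' ll' _] := compact_adjoint cl.
have h1 : compact_operator (fun z => flip psi (step (c := c) 0) (phi (step (c := c) 0) z)).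
  apply: (@compact_step_product _ _ _ c c_gt0 phi (flip psi) (cut_inv d)
    (fun x => - cut_inv d x) k l) => //.
  - exact: real_calculus_flip.
  - by move=> x dx; rewrite iE.
  - by rewrite /flip NiN.
  - by move=> z; rewrite /flip NiN.
  - by move=> z; rewrite /flip NiN.
(* Now both inverses are replaced by their opposites; being linear, the two resolvent identities
   persist with the same [k] and [l]. *)
have h2 : compact_operator (fun z => psi (step (c := c) 0) (flip phi (step (c := c) 0) z)).
  apply: (@compact_step_product _ _ _ c c_gt0 (flip phi) psi (cut_inv d)
    (fun x => - cut_inv d x) k l) => //.
  - exact: real_calculus_flip.
  - by move=> x dx; rewrite iE.
  - by rewrite /flip iN; exact: oppdense.
  - exact: oppdense.
  - by move=> z; rewrite /flip iN !opp // resolvent_k.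
  - move=> z; rewrite /flip iN !opp // resolvent_l.
    by rewrite (adjoint_pair_opp ll') opprB opprK addrC.
(* With [P] and [Q] the projections of [phi] and [psi], [Q - P = Q (1 - P) - (1 - Q) P]. *)
have := compactB h2 h1; congr compact_operator; apply/funext => z.
rewrite !flip_step // (adjoint_pair_sub (cal_adj cpsi cs)).
by rewrite opprB addrA subrK.
Qed.

End ProjectionDifference.

(** * The two factorizations of the difference of inverses *)

Section Perturbation.
Context {R : realType} {A : cstarAlgType R} {E : hilbertModType A}.
Context {T S : operator E}.
Hypotheses (T_linear : linear_operator T) (T_symmetric : symmetric_operator T).
Hypothesis T_invertible : invertible T.
Hypotheses (S_linear : linear_operator S) (S_dense : dense (dom S)).
Hypotheses (S_symmetric : symmetric_operator S) (domTS : dom T `<=` dom S).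
Hypothesis TS_invertible : invertible (op_add T S).
Hypothesis Sr_compact : compact_operator (fun x => S (op_inv (op_shift T 'i) x)).

Let b := op_inv T.
Let b' := op_inv (op_add T S).

Lemma op_add_linear : linear_operator (op_add T S).
Proof.
have [T0 TD TZ TA] := T_linear; have [S0 SD SZ SA] := S_linear; split=> //=.
- move=> x y [Tx Sx] [Ty Sy]; have [Txy ->] := TD _ _ Tx Ty.
  by have [Sxy ->] := SD _ _ Sx Sy; rewrite addrACA.
- move=> z x [Tx Sx]; have [Tzx ->] := TZ z _ Tx.
  by have [Szx ->] := SZ z _ Sx; rewrite scalerDr.
- move=> a x [Tx Sx]; have [Tax ->] := TA a _ Tx.
  by have [Sax ->] := SA a _ Sx; rewrite hactDl.
Qed.

Lemma op_add_symmetric : symmetric_operator (op_add T S).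
Proof.
by move=> x y [Tx Sx] [Ty Sy] /=; rewrite hipDl hipDr T_symmetric ?S_symmetric.
Qed.

Let bP z : dom T (b z) /\ T (b z) = z.
Proof. by have [_ rT _] := T_invertible; exact: op_inv_full. Qed.

Let b'P z : (dom T (b' z) /\ dom S (b' z)) /\ T (b' z) + S (b' z) = z.
Proof. by have [_ rTS _] := TS_invertible; exact: (op_inv_full z rTS). Qed.

Let bb : adjoint_pair b b.
Proof. by have [_ rT _] := T_invertible; exact: op_inv_adjoint. Qed.

Let bb' : adjoint_pair b' b'.
Proof.
have [_ rTS _] := TS_invertible.
by apply: op_inv_adjoint => //; exact: op_add_symmetric.
Qed.

(** From [(T + i) b = 1 + i b] follows [b = (T + i)^-1 (1 + i b)]; hence [S b] is the given compact
    operator times an adjointable one. *)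
Lemma compact_S_inv : compact_operator (S \o b).
Proof.
have rE z : b z = op_inv (op_shift T 'i) (z + 'i *: b z).
  have [Tb TbE] := bP z; rewrite -{2}TbE.
  by rewrite (@op_invK _ _ _ (op_shift T 'i) _
    (op_shift_i_injective T_linear T_symmetric)).
have -> : S \o b = (fun x => S (op_inv (op_shift T 'i) x)) \o
    (fun z => z + 'i *: b z).
  by apply/funext => z; exact: (congr1 S (rE z)).
apply: (@compact_compr _ _ _ _ _ (fun z => z - 'i *: b z)) => // x y.
rewrite hipDl hipBr hipZl hipZr bb; congr (_ + _); rewrite -scaleNr.
by congr (_ *: _); simpc.
Qed.

(* [b - b' = b' (S b) = b (S b')]; [S b'] is bounded because it has a densely
   defined adjoint, and compact because [S b' = (S b) (1 - S b')]. *)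
Lemma resolvent_factors : exists k l : E -> E,
  [/\ compact_operator k, compact_operator l,
      forall z, b z = b' (z + k z) & forall z, b' z = b z - l (b z)].
Proof.
have [injT _ _] := T_invertible; have [injTS _ _] := TS_invertible.
have [S0 SD SZ _] := S_linear.
have adj x y : dom S y -> hip (S (b' x)) y = hip x (b' (S y)).
  by move=> Sy; have [[_ Sb'] _] := b'P x; rewrite S_symmetric // bb'.
have [C C0 hC] : exists2 C : R, 0 <= C & bounded_by C (S \o b').
  apply: (@dense_adjoint_bounded _ _ _ (S \o b') (dom S) (b' \o S)) => //.
  move=> a y Sy; have [Say SayE] := SZ a y Sy; split=> //.
  by rewrite /comp SayE (adjoint_pair_scale bb').
have Tb' z : T (b' z) = z - S (b' z).
  by have [_ {2}<-] := b'P z; rewrite addrK.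
have bTb' z : b (z - S (b' z)) = b' z.
  by rewrite -Tb'; apply: op_invK => //; have [[]] := b'P z.
have cSb' : compact_operator (S \o b').
  have -> : S \o b' = (S \o b) \o (fun z => z - S (b' z)).
    by apply/funext => z; exact: (congr1 S (esym (bTb' z))).
  apply: (@compact_compr_dense _ _ _ _ _ (dom S) (fun y => y - b' (S y)) (1 + C)).
  - exact: S_dense.
  - move=> z; rewrite (le_trans (rnormB _ _)) // mulrDl mul1r lerD2l; exact: hC.
  - by move=> x y Sy; rewrite hipBl hipBr adj.
  - exact: compact_S_inv.
have [l Sb'l cl] := compact_adjoint cSb'.
exists (S \o b), l; split=> //; first exact: compact_S_inv.
  move=> z; have [Tb TbE] := bP z; rewrite /comp -{2}TbE.
  by rewrite (@op_invK _ _ _ (op_add T S)) //; split=> //; exact: domTS.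
(* Tested against [w], the term [l (b z)] becomes [hip (b (S (b' w))) z], and [b S b' = b - b']. *)
move=> z; apply: hip_injr => w; rewrite hipBr -Sb'l /comp.
have -> : hip (S (b' w)) (b z) = hip (b (S (b' w))) z by rewrite bb.
have -> : b (S (b' w)) = b w - b' w.
  by rewrite -[X in _ = _ - X](bTb' w) -(adjoint_pair_sub bb) opprB addrC subrK.
by rewrite hipBl bb bb' opprB addrC subrK.
Qed.

End Perturbation.

Lemma positive_spectral_projectionE (R : realType) (A : cstarAlgType R)
    (E : hilbertModType A) (T : operator E) (P : E -> E) (Phi : (R -> R[i]) -> E -> E)
    (chi : R -> R) (c : R) :
    0 < c -> functional_calculus T Phi ->
    (forall x : R, `|x| < grid (c := c) 1 -> ~ spectrum T x) ->
    continuous chi ->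
    (forall x, spectrum T x -> x < 0 -> chi x = 0) ->
    (forall x, spectrum T x -> 0 < x -> chi x = 1) ->
    P =1 Phi (fun x => (chi x)%:C) ->
  P =1 Phi (fun x => (step (c := c) 0 x)%:C).
Proof.
move=> c0 [eqPhi _ _ _ _] gap cchi chi0 chi1 PE z; rewrite PE.
have g0 := grid_gt0 c0.
have chiE x : spectrum T x -> chi x = step (c := c) 0 x.
  move=> Tx; have dx : grid (c := c) 1 <= `|x| by rewrite leNgt; apply/negP => /gap.
  have [x0|x0|x0] := ltrgt0P x.
  - by rewrite chi1 // step1 // -(gtr0_norm x0).
  - by rewrite chi0 // step0 // (le_trans (ltW x0)) // ltW.
  - by move: dx; rewrite x0 normr0 leNgt g0.
apply: eqPhi; last by move=> x Tx; rewrite chiE.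
(* Off the spectrum [chi] may be unbounded; only its values on the spectrum, those of [step 0],
   enter the bound. *)
- split; first by apply: within_continuous_complex => //; exact: cst_continuous.
  exists 1 => x Tx; rewrite chiE // ger0_norm ?ler0c ?step_ge0 //.
  by rewrite lecR step_le1.
- exact/cbounded_complex/cbounded_step.
Qed.

Theorem corollaryA10 (R : realType) (A : cstarAlgType R) (E : hilbertModType A)
    (T S : operator E) (P Q : E -> E)
    (T_regular : regular_operator T) (T_self_adjoint : self_adjoint T)
    (S_densely_defined : densely_defined S) (S_symmetric : symmetric_operator S)
    (S_relatively_compact : relatively_compact T S)
    (T_invertible : invertible T) (TS_invertible : invertible (op_add T S))
    (P_projection : positive_spectral_projection T P)
    (Q_projection : positive_spectral_projection (op_add T S) Q) :
  compact_operator (fun x => Q x - P x).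
Proof.
have [[T_linear T_dense] _ _ _] := T_regular.
have [S_linear S_dense] := S_densely_defined.
have [domTS Sr_compact _] := S_relatively_compact.
have T_symmetric := self_adjoint_symmetric T_self_adjoint.
have TS_linear := op_add_linear T_linear S_linear.
have TS_symmetric := op_add_symmetric T_symmetric S_symmetric.
have [d1 d1_gt0 gapT] := spectrum_gap T_linear T_symmetric T_invertible.
have [d2 d2_gt0 gapTS] := spectrum_gap TS_linear TS_symmetric TS_invertible.
pose d := Num.min d1 d2; have d_gt0 : 0 < d by rewrite lt_min d1_gt0.
(* The choice makes [grid 1 = d], so [step 0] rises from 0 to 1 inside the common gap of both
   spectra. *)
pose c := 3 / 4 * d; have c_gt0 : 0 < c by rewrite mulr_gt0.
have gd : grid (c := c) 1 = d by rewrite /grid /c expr1; field.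
have {}gapT x : `|x| < grid (c := c) 1 -> ~ spectrum T x.
  by rewrite gd lt_min => /andP[/gapT].
have {}gapTS x : `|x| < grid (c := c) 1 -> ~ spectrum (op_add T S) x.
  by rewrite gd lt_min => /andP[_ /gapTS].
have [Phi [chi [PhiT cchi chi0 chi1 PE]]] := P_projection.
have [Psi [chi' [PsiTS cchi' chi'0 chi'1 QE]]] := Q_projection.
have {PE} PE := positive_spectral_projectionE c_gt0 PhiT gapT cchi chi0 chi1 PE.
have {QE} QE :=
  positive_spectral_projectionE c_gt0 PsiTS gapTS cchi' chi'0 chi'1 QE.
have [k [l [ck cl hk hl]]] := resolvent_factors T_linear T_symmetric T_invertible
  S_linear S_dense S_symmetric domTS TS_invertible Sr_compact.
have g_gt0 : 0 < grid (c := c) 1 by rewrite gd.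
have phiE := calculus_cut_inv T_linear T_symmetric T_invertible PhiT g_gt0 gapT.
have psiE :=
  calculus_cut_inv TS_linear TS_symmetric TS_invertible PsiTS g_gt0 gapTS.
have dense_sub (D : set E) : dom T `<=` D -> dense D.
  by move=> TD O O0 Oo; have [x [Ox /TD Dx]] := T_dense O O0 Oo; exists x.
have := @compact_projection_difference _ _ _ c c_gt0
  (fun f => Phi (fun x => (f x)%:C)) (fun f => Psi (fun x => (f x)%:C)) k l.
have -> : (fun z => Q z - P z) = fun z => Psi (fun x => (step (c := c) 0 x)%:C) z -
    Phi (fun x => (step (c := c) 0 x)%:C) z.
  by apply/funext => z; rewrite PE QE.
apply=> //.
- exact: real_calculusP c_gt0 PhiT gapT.
- exact: real_calculusP c_gt0 PsiTS gapTS.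
- apply: dense_sub => x Tx; exists (T x) => //; rewrite phiE.
  by apply: op_invK => //; case: T_invertible.
- apply: dense_sub => x Tx; exists (op_add T S x) => //; rewrite psiE.
  by apply: op_invK; [case: TS_invertible | split=> //; exact: domTS].
- by move=> z; rewrite phiE psiE hk.
- by move=> z; rewrite phiE psiE hl.
Qed.
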